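(* Let $\theta\in(0,\infty)$ and let $d$ be an integer with $d>2(1+\theta)$. Define $$T(\theta,d)=\frac{2\theta\log(\theta)}{(\theta-1)(d-2(1+\theta))}\ \text{ if }\theta\ne 1,\qquad T(1,d)=\frac{2}{d-4}.$$ For $\eta>0$ let $A_\eta$ be the event that the permutation $X_t$ has a cycle of size larger than $\eta|V|$. (i) For every $\epsilon$ with $0<\epsilon<\frac{d-2}{2}$, there exists $\eta>0$ such that for all $b\ge a\ge 0$, $$p_{n,d}\left(\int_{a}^{b}\mathbb{P}_{\theta,t}(A_\eta)\,dt\ \ge\ \frac{(b-a)\left(\frac d2-(\theta+1)(1+\epsilon)\right)-T(\theta,d)\left(\frac d2-(1+\theta)\right)}{(1+\theta)\left(\frac d2-(1+\epsilon)\right)}\right)\longrightarrow 1\quad\text{as }n\to\infty.$$ (ii) For every $\delta>0$ there exist $\eta>0$ and $c>0$ such that for all $a\ge 0$, $$p_{n,d}\left(\exists\, t\in[a,a+T(\theta,d)+\delta]\text{ such that }\mathbb{P}_{\theta,t}(A_\eta)\ge c\right)\longrightarrow 1\quad\text{as }n\to\infty.$$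
   Context: Random graph: $p_{n,d}$ denotes the uniform probability measure on (simple) $d$-regular graphs with $n$ vertices, i.e. graphs on vertex set $V=\{1,\dots,n\}$ in which every vertex has degree $d$; limits $n\to\infty$ are taken along $n$ with $nd$ even. Interchange process: for a finite graph $G=(V,E)$, $(X_t)_{t\ge 0}$ is the continuous-time Markov jump process on the set of permutations of $V$, started at the identity permutation $X_0=\mathrm{id}$, which for each edge $\{x,y\}\in E$ jumps from $\sigma$ to $\tau_{\{x,y\}}\cdot\sigma$ at rate $1$. Here $\tau_{\{x,y\}}$ is the transposition exchanging $x$ and $y$, and $(\sigma_1\cdot\sigma_2)(x)=\sigma_1(\sigma_2(x))$. $\mathbb{E}$ is the expectation with respect to this process on the fixed graph $G$. Weighted measure: $N(\sigma)$ is the number of cycles of a permutation $\sigma$ (fixed points count as cycles). For $\theta\in(0,\infty)$ and $t\ge 0$, $$Z_\theta(t)=\mathbb{E}\left(\theta^{N(X_t)}\right),\qquad \mathbb{P}_{\theta,t}(A)=\frac{1}{Z_\theta(t)}\mathbb{E}\left(\theta^{N(X_t)}1_A\right).$$ Under $p_{n,d}$, the quantities $\mathbb{P}_{\theta,t}(A_\eta)$ are random variables depending on the random graph $G$. *)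

(* Defs.v *)
From HB Require Import structures.
From mathcomp Require Import all_boot all_order all_algebra all_fingroup.
From mathcomp Require Import all_classical all_reals all_analysis.
Import Order.TTheory GRing.Theory Num.Theory.
Import numFieldNormedType.Exports.

Set Implicit Arguments.
Unset Strict Implicit.
Unset Printing Implicit Defensive.

Local Open Scope ring_scope.

(* Simple graphs on the vertex set 'I_n, given by their sets of edges: an edge
   is a two-element set of vertices. *)
Record sgraph (n : nat) := SGraph {
  edges : {set {set 'I_n}};
  _ : [forall e in edges, #|e| == 2%N]
}.

HB.instance Definition _ (n : nat) := [isSub for @edges n].
HB.instance Definition _ (n : nat) := [Countable of sgraph n by <:].
HB.instance Definition _ (n : nat) := [Finite of sgraph n by <:].

Definition regular (n d : nat) (G : sgraph n) : bool :=
  [forall v : 'I_n, #|[set e in edges G | v \in e]%SET| == d].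

(* When there is no d-regular graph on n vertices (n <= d or n * d odd) this is
   0 / 0 = 0. *)
Definition regular_prob (R : realType) (n d : nat) (A : sgraph n -> Prop) : R :=
  #|[set G : sgraph n | regular d G && `[< A G >]]%SET|%:R /
  #|[set G : sgraph n | regular d G]%SET|%:R.

(* Every edge {x, y} of G is counted once, with x < y.  The product of
   permutations reads from left to right, (s * tperm x y) z = tperm x y (s z),
   so s * tperm x y is s followed by the transposition. *)
Definition jump_rate (R : realType) (n : nat) (G : sgraph n) (s s' : 'S_n) : R :=
  \sum_(x < n) \sum_(y < n | (x < y)%N && ([set x; y]%SET \in edges G))
    (s' == (s * tperm x y)%g)%:R.

Section Interchange.
Local Open Scope classical_set_scope.

(* The events of the past up to time t of a process with values in S: the
   sigma-algebra generated by the variables X_u, 0 <= u <= t. *)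
Definition past (R : realType) (S : finType) (Omega : Type) (X : R -> Omega -> S)
    (t : R) : set (set Omega) :=
  <<s [set H | exists u s, 0 <= u <= t /\ H = X u @^-1` [set s]] >>.

(* Only times t >= 0 are meaningful.  [ip_trans h s s'] is the probability of
   going from s to s' in time h; [ip_markov] does not constrain it at states s
   which the process cannot reach, and its diagonal behaviour at 0 follows, at
   reachable states, from [ip_rate] and conservation of mass. *)
Record interchange_process (R : realType) (n : nat) (G : sgraph n) :=
  InterchangeProcess {
  ip_display : measure_display;
  ip_space : measurableType ip_display;
  ip_prob : probability ip_space R;
  ip_path : R -> ip_space -> 'S_n;
  ip_trans : R -> 'S_n -> 'S_n -> R;
  ip_measurable : forall (t : R) (s : 'S_n), 0 <= t ->
    measurable (ip_path t @^-1` [set s]);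
  ip_start : forall w, ip_path 0 w = 1%g;
  ip_right_continuous : forall w (t : R), 0 <= t ->
    \forall u \near t^'+, ip_path u w = ip_path t w;
  ip_left_limits : forall w (t : R), 0 < t ->
    exists s : 'S_n, \forall u \near t^'-, ip_path u w = s;
  ip_markov : forall (t h : R) (H : set ip_space) (s s' : 'S_n),
    0 <= t -> 0 <= h -> past ip_path t H ->
    ip_prob (H `&` ip_path t @^-1` [set s] `&` ip_path (t + h) @^-1` [set s'])
    = (ip_prob (H `&` ip_path t @^-1` [set s]) * (ip_trans h s s')%:E)%E;
  ip_rate : forall s s' : 'S_n, s != s' ->
    ip_trans h s s' / h @[h --> 0^'+] --> jump_rate R G s s'
}.

Arguments ip_space {R n G} i.
Arguments ip_prob {R n G} i.
Arguments ip_path {R n G} i t w : rename.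

Variables (R : realType) (n : nat) (G : sgraph n).
Variable X : interchange_process R G.

Definition cycle_number (s : 'S_n) : nat := #|porbits s|.

Definition partition_function (theta t : R) : R :=
  fine 'E_(ip_prob X)[fun w => theta ^+ cycle_number (ip_path X t w)].

Definition weighted_prob (theta t : R) (A : set (ip_space X)) : R :=
  fine 'E_(ip_prob X)[fun w => theta ^+ cycle_number (ip_path X t w) * \1_A w]
  / partition_function theta t.

Definition large_cycle_event (eta t : R) : set (ip_space X) :=
  [set w | exists2 C : {set 'I_n},
     C \in porbits (ip_path X t w) & eta * n%:R < #|C|%:R].

(* The weighted probability, at time t, that X_t has a cycle of size larger
   than eta * n. *)
Definition weighted_large_cycle (theta eta t : R) : R :=
  weighted_prob theta t (large_cycle_event eta t).

End Interchange.

Definition critical_time (R : realType) (theta : R) (d : nat) : R :=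
  if theta == 1 then 2 / (d%:R - 4)
  else 2 * theta * ln theta / ((theta - 1) * (d%:R - 2 * (1 + theta))).

(* n tends to infinity along the n for which n * d is even. *)
Definition even_infty (d : nat) : set_system nat :=
  within [set n | ~~ odd (n * d)]%classic \oo%classic.

(* Main.v *)
Require Import Defs.
From HB Require Import structures.
From mathcomp Require Import all_boot all_order all_algebra all_fingroup.
From mathcomp Require Import all_classical all_reals all_analysis.
From mathcomp Require Import zify lra ring.
Import Order.TTheory GRing.Theory Num.Theory.
Import numFieldNormedType.Exports.

Set Implicit Arguments.
Unset Strict Implicit.
Unset Printing Implicit Defensive.

(** Let [Z t] be the expectation of [theta ^ N] at time [t], where [N] is the
    number of cycles.  Composing a permutation with the transposition of an
    edge raises [N] by one if the ends of the edge lie in the same cycle (the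
    edge is then called internal), and lowers it by one otherwise.  Hence, by
    the forward equation of the process, if [I t] denotes the weighted mean of
    the number of internal edges and [E] the number of edges,
      [theta / (theta - 1) * (ln Z)' = (1 + theta) * I - E].
    Since [ln Z] always lies between [0] and [n * ln theta], the integral of
    [(1 + theta) * I - E] over any time interval is at least [- n * kappa],
    with [kappa = theta * ln theta / (theta - 1)].  When [theta = 1] the mean
    of [N], which lies between [0] and [n], replaces the left-hand side, and
    [kappa = 1].  This is [potential_exists]; so, over a long time, at least
    about a proportion [1 / (1 + theta)] of the [n * d / 2] edges is internal.

    On the other hand, with probability tending to 1, every set [S] of at most
    [eta * n] vertices of a random regular graph spans at most
    [(1 + eps) * |S|] edges ([card_not_sparse]).  In such a graph there are at
    most [(1 + eps) * n] internal edges when all cycles have size at most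
    [eta * n], whence
      [I <= (1 + eps) * n + n * (d / 2 - (1 + eps)) * P],
    where [P] is the weighted probability of a large cycle.  Integrating gives
    part (i) ([integral_large_cycle]); part (ii) is part (i) on an interval of
    length [T + delta], with [eps] so small that the bound is positive.

    The sparsity of random regular graphs is a union bound.  It rests on the
    estimate that a given set of [m] pairs is contained in the random graph
    with probability at most [(2 * d / n) ^ m] ([card_regular_with_le]), which
    is proved by switching two edges.  The uniform measure is a quotient by
    the number of regular graphs, so these must also be shown to exist
    ([regular_exists]).

    The rates of the process are only prescribed through the right derivative
    at 0 of its transition probabilities.  They give right derivatives of the
    means at all times; these are uniform in time, and this alone makes the
    means continuously differentiable ([clip_is_derive]). *)

(** * Switchings in regular graphs *)

Section Switching.
Import boot.fintype boot.finset.
Local Open Scope set_scope.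
Local Open Scope nat_scope.

Lemma card_edge n (G : sgraph n) e : e \in edges G -> #|e| = 2.
Proof. by case: G => E /= /forallP/(_ e)/implyP hE /hE/eqP. Qed.

Lemma edge_neq n (G : sgraph n) x y : [set x; y] \in edges G -> x != y.
Proof. by move=> /card_edge; rewrite cards2; case: eqP. Qed.

Definition neighbours n (G : sgraph n) (u : 'I_n) : {set 'I_n} :=
  [set x | [set u; x] \in edges G].

Lemma set2_injr (T : finType) (u x y : T) : [set u; x] = [set u; y] -> x = y.
Proof.
move=> e; have : x \in [set u; y] by rewrite -e set22.
have : y \in [set u; x] by rewrite e set22.
by rewrite !inE => /orP[/eqP->|/eqP->//] /orP[/eqP->|/eqP->].
Qed.

Lemma set2_inj (T : finType) (a b x y : T) : [set a; b] = [set x; y] ->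
  (a = x /\ b = y) \/ (a = y /\ b = x).
Proof.
move=> e; have : a \in [set x; y] by rewrite -e set21.
rewrite !inE => /orP[/eqP ax|/eqP ay].
  by left; split=> //; apply: (@set2_injr _ a); rewrite e ax.
by right; split=> //; apply: (@set2_injr _ a); rewrite e ay setUC.
Qed.

Lemma edges_at_neighbours n (G : sgraph n) u :
  [set e in edges G | u \in e] = [set [set u; x] | x in neighbours G u].
Proof.
apply/setP => e; rewrite inE; apply/andP/imsetP => [[eG ue]|[x]].
  have /eqP/cards2P[a [b [ab eE]]] := card_edge eG.
  move: ue eG; rewrite {}eE !inE => /orP[]/eqP <- eG.
    by exists b => //; rewrite inE.
  by exists a; rewrite ?inE setUC.
by rewrite inE => h ->; rewrite set21.
Qed.

Lemma card_neighbours n (G : sgraph n) u :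
  #|neighbours G u| = #|[set e in edges G | u \in e]|.
Proof.
rewrite edges_at_neighbours card_imset // => x y; exact: set2_injr.
Qed.

Lemma regular_neighbours n d (G : sgraph n) u :
  regular d G -> #|neighbours G u| = d.
Proof. by move=> /forallP/(_ u)/eqP <-; rewrite card_neighbours. Qed.

Lemma regular_degree n d (G : sgraph n) :
  regular d G = [forall u, \sum_(e in edges G) (u \in e) == d].
Proof.
apply: eq_forallb => u; congr (_ == _); rewrite -sum1_card.
rewrite big_mkcond [RHS]big_mkcond; apply: eq_bigr => e _.
by rewrite inE; case: (_ \in _) => //=; case: (_ \in _).
Qed.

(** The edge [uv] is to be removed from [G] and [F] to be kept: these are the
    edges [xy], with a choice of orientation, such that replacing [uv] and [xy]
    by [ux] and [vy] yields a simple graph of the same degrees. *)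
Definition switchable n (G : sgraph n) (F : {set {set 'I_n}}) (u v : 'I_n) :
    {set 'I_n * 'I_n} :=
  [set p | [&& [set p.1; p.2] \in edges G, [set p.1; p.2] \notin F,
     p.1 != u, p.2 != v, [set u; p.1] \notin edges G
   & [set v; p.2] \notin edges G]].

Definition regular_with n d (F : {set {set 'I_n}}) : {set sgraph n} :=
  [set G | regular d G && (F \subset edges G)].

Definition switch_edges n (E : {set {set 'I_n}}) (u v x y : 'I_n) :=
  [set u; x] |: ([set v; y] |: (E :\ [set u; v] :\ [set x; y])).

Lemma switch_edges_card n (G : sgraph n) u v x y : u != x -> v != y ->
  [forall e in switch_edges (edges G) u v x y, #|e| == 2].
Proof.
move=> ux vy; apply/forallP => e; apply/implyP; rewrite !inE => /or3P[/eqP->|/eqP->|].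
- by rewrite cards2 ux.
- by rewrite cards2 vy.
by move=> /and3P[_ _ /card_edge ->].
Qed.

(** The default value of [insubd] is taken only when [u = x] or [v = y]. *)
Definition switch n (G : sgraph n) (u v x y : 'I_n) : sgraph n :=
  insubd G (switch_edges (edges G) u v x y).

Lemma edges_switch n (G : sgraph n) u v x y : u != x -> v != y ->
  edges (switch G u v x y) = switch_edges (edges G) u v x y.
Proof.
move=> ux vy; have := val_insubd G (switch_edges (edges G) u v x y).
by rewrite switch_edges_card.
Qed.

Lemma switchP n d (G : sgraph n) (F : {set {set 'I_n}}) (u v x y : 'I_n) :
  u != v -> [set u; v] \notin F ->
  G \in regular_with d ([set u; v] |: F) -> (x, y) \in switchable G F u v ->
  [/\ switch G u v x y \in regular_with d F,
      x \in neighbours (switch G u v x y) u,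
      y \in neighbours (switch G u v x y) v
    & edges G = [set u; v] |: ([set x; y] |:
        (edges (switch G u v x y) :\ [set u; x] :\ [set v; y]))].
Proof.
move=> uv uvF; rewrite !inE subUset sub1set => /and3P[rG uvG FG].
move=> /and5P[/= xyG xyF xu yv /andP[uxG vyG]].
have xy := edge_neq xyG.
have E := edges_switch G (u := u) (v := v) (x := x) (y := y).
rewrite eq_sym in xu; rewrite eq_sym in yv; have {}E := E xu yv.
have xv : x != v by apply: contraNneq uxG => ->.
have yu : y != u by apply: contraNneq vyG => ->; rewrite setUC.
have uv_xy : [set u; v] != [set x; y].
  apply/eqP => /set2_inj[[ux _]|[uy _]]; first by rewrite ux eqxx in xu.
  by rewrite uy eqxx in yu.
have ux_vy : [set u; x] != [set v; y].
  apply/eqP => /set2_inj[[ux _]|[uy _]]; first by rewrite ux eqxx in uv.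
  by rewrite uy eqxx in yu.
have uv_ux : [set u; x] != [set u; v] by apply: contraNneq uxG => ->.
have xy_ux : [set u; x] != [set x; y] by apply: contraNneq uxG => ->.
have uv_vy : [set v; y] != [set u; v] by apply: contraNneq vyG => ->.
have xy_vy : [set v; y] != [set x; y] by apply: contraNneq vyG => ->.
split; rewrite ?inE E ?inE ?eqxx ?orbT //; last first.
  apply/setP => e; rewrite !inE.
  have [->|e1] := eqVneq e [set u; v]; first by rewrite uvG.
  have [->|e2] := eqVneq e [set x; y]; first by rewrite xyG orbT.
  have [->|e3] := eqVneq e [set v; y]; first by rewrite (negbTE vyG).
  have [->|e4] := eqVneq e [set u; x]; first by rewrite (negbTE uxG).
  by [].
apply/andP; split; last first.
  apply/subsetP => e eF; rewrite !inE (subsetP FG e eF) andbT.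
  apply/orP; right; apply/orP; right; apply/andP; split.
    by apply: contraNneq xyF => <-.
  by apply: contraNneq uvF => <-.
rewrite regular_degree in rG; rewrite regular_degree.
apply/forallP => w; rewrite E; move/forallP: rG => /(_ w)/eqP <-; apply/eqP.
have uvG' : [set x; y] \in edges G :\ [set u; v] by rewrite !inE xyG eq_sym uv_xy.
rewrite (big_setD1 _ uvG) /= (big_setD1 _ uvG') /=.
rewrite !big_setU1 /=; last 2 first.
- by rewrite !inE (negbTE vyG) !andbF.
- by rewrite !inE (negbTE uxG) !andbF (negbTE ux_vy).
rewrite !addnA; congr (_ + _); rewrite !inE.
have exclusive (a b : 'I_n) : a != b -> (w == a) && (w == b) = false.
  by move=> ab; apply/andP => -[/eqP wa /eqP wb]; rewrite -wa -wb eqxx in ab.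
move: (exclusive _ _ uv) (exclusive _ _ xy) (exclusive _ _ xu) (exclusive _ _ yv).
by case: (w == u); case: (w == v); case: (w == x); case: (w == y).
Qed.

Lemma card_regular_pairs n d (G : sgraph n) : regular d G ->
  #|[set p : 'I_n * 'I_n | [set p.1; p.2] \in edges G]| = n * d.
Proof.
move=> rG; rewrite -sum1_card (eq_bigl (fun p => true && (p.2 \in neighbours G p.1))).
  rewrite -(pair_big_dep predT (fun x y => y \in neighbours G x) (fun _ _ => 1)) /=.
  rewrite (eq_bigr (fun=> d)) => [|x _]; last by rewrite sum1_card (regular_neighbours _ rG).
  by rewrite sum_nat_const card_ord.
by case=> x y; rewrite !inE.
Qed.

Lemma card_pairs_in n (F : {set {set 'I_n}}) :
  #|[set p : 'I_n * 'I_n | (p.1 != p.2) && ([set p.1; p.2] \in F)]| <= 2 * #|F|.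
Proof.
rewrite -sum1_card (partition_big (fun p => [set p.1; p.2]) (mem F)) /=; last first.
  by move=> p; rewrite inE => /andP[].
rewrite mulnC -sum_nat_const; apply: leq_sum => f fF.
rewrite sum1_card.
case: (pickP [pred p : 'I_n * 'I_n | [set p.1; p.2] == f]) => [[a b]|no] /=.
  move=> /eqP <-; apply: leq_trans (_ : #|[set (a, b); (b, a)]| <= _).
    apply: subset_leq_card; apply/subsetP => -[x y].
    rewrite !inE => /andP[_ /eqP] /set2_inj[[/= -> ->]|[/= -> ->]];
    by rewrite eqxx ?orbT.
  by rewrite cards2; case: eqP.
rewrite eq_card0 // => p; have := no p; rewrite !inE /= => h.
by rewrite unfold_in h andbF.
Qed.

Lemma card_paths2 n d (G : sgraph n) (u : 'I_n) : regular d G ->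
  #|[set p : 'I_n * 'I_n | (p.1 \in neighbours G u) && (p.2 \in neighbours G p.1)]|
    <= d ^ 2.
Proof.
move=> rG; rewrite -sum1_card.
rewrite (eq_bigl (fun p => (p.1 \in neighbours G u) && (p.2 \in neighbours G p.1))).
  rewrite -(pair_big_dep (mem (neighbours G u))
    (fun x y => y \in neighbours G x) (fun _ _ => 1)) /=.
  rewrite (eq_bigr (fun=> d)) => [|x _]; last by rewrite sum1_card (regular_neighbours _ rG).
  by rewrite sum_nat_const (regular_neighbours _ rG).
by case=> x y; rewrite inE.
Qed.

(** The excluded pairs are those with [xy] in [F], with [x = u] or [y = v], and
    those for which [u, x, y] or [v, y, x] is a path. *)
Lemma card_switchable n d (G : sgraph n) (F : {set {set 'I_n}})
    (u v : 'I_n) : regular d G ->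
  n * d <= #|switchable G F u v| + (2 * #|F| + 2 * d + 2 * d ^ 2).
Proof.
move=> rG; rewrite -(card_regular_pairs rG).
pose A := switchable G F u v.
pose B := [set p : 'I_n * 'I_n | (p.1 != p.2) && ([set p.1; p.2] \in F)].
pose swap (p : 'I_n * 'I_n) := (p.2, p.1).
have swapI : injective swap by move=> [a b] [a' b'] [-> ->].
pose C1 := [set (u, y) | y in neighbours G u].
pose C2 := [set (x, v) | x in neighbours G v].
pose D w := [set p : 'I_n * 'I_n | (p.1 \in neighbours G w) && (p.2 \in neighbours G p.1)].
apply: (@leq_trans #|A :|: (B :|: (C1 :|: C2) :|: (D u :|: swap @: D v))|).
  apply: subset_leq_card; apply/subsetP => -[x y]; rewrite inE /= => xyG.
  have xy := edge_neq xyG.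
  have [xyF|xyF] := boolP ([set x; y] \in F); first by rewrite !inE xy xyF !orbT.
  have [xu|xu] := eqVneq x u.
    have : (x, y) \in C1 by apply/imsetP; exists y; rewrite ?xu // inE -xu.
    by rewrite !inE => ->; rewrite !orbT.
  have [yv|yv] := eqVneq y v.
    have : (x, y) \in C2 by apply/imsetP; exists x; rewrite ?yv // inE -yv setUC.
    by rewrite !inE => ->; rewrite !orbT.
  have [uxG|uxG] := boolP ([set u; x] \in edges G).
    by rewrite !inE /= uxG xyG !orbT.
  have [vyG|vyG] := boolP ([set v; y] \in edges G).
    have : (x, y) \in swap @: D v.
      by apply/imsetP; exists (y, x); rewrite // !inE /= vyG setUC.
    by rewrite in_setU !in_setU => ->; rewrite !orbT.
  by rewrite !inE /= xyG xyF xu yv uxG vyG.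
have c1 : #|C1| = d.
  by rewrite card_imset ?(regular_neighbours _ rG) // => y y' [].
have c2 : #|C2| = d.
  by rewrite card_imset ?(regular_neighbours _ rG) // => y y' [].
have cB : #|B| <= _ := card_pairs_in F.
have cDu : #|D u| <= _ := card_paths2 u rG.
have cDv : #|swap @: D v| <= d ^ 2.
  by rewrite card_imset //; apply: card_paths2.
have leU (X Y : {set 'I_n * 'I_n}) : #|X :|: Y| <= #|X| + #|Y|.
  by rewrite cardsU leq_subr.
have h1 := leU A (B :|: (C1 :|: C2) :|: (D u :|: swap @: D v)).
have h2 := leU (B :|: (C1 :|: C2)) (D u :|: swap @: D v).
have h3 := leU B (C1 :|: C2).
have h4 := leU C1 C2.
have h5 := leU (D u) (swap @: D v).
apply: leq_trans h1 _; rewrite leq_add2l; apply: leq_trans h2 _.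
have h34 : #|B :|: (C1 :|: C2)| <= 2 * #|F| + 2 * d.
  apply: leq_trans h3 _; rewrite leq_add ?cB //; apply: leq_trans h4 _.
  by rewrite c1 c2 mul2n addnn.
apply: leq_add h34 _; apply: leq_trans h5 _.
by rewrite mul2n -addnn leq_add.
Qed.

(** Double counting of the pairs formed by a graph containing [uv] and a
    switchable [(x, y)]: such a pair can be recovered from the switched graph
    and [(x, y)], and in the switched graph [x] and [y] are neighbours of [u]
    and [v], which leaves at most [d ^ 2] choices for them. *)
Lemma card_regular_with_switch n d (F : {set {set 'I_n}}) (u v : 'I_n) :
  u != v -> [set u; v] \notin F ->
  #|regular_with d ([set u; v] |: F)| * (n * d - (2 * #|F| + 2 * d + 2 * d ^ 2))
    <= d ^ 2 * #|regular_with d F|.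
Proof.
move=> uv uvF; set R1 := regular_with d _; set R0 := regular_with d F.
pose P1 := [set q : sgraph n * ('I_n * 'I_n) |
  (q.1 \in R1) && (q.2 \in switchable q.1 F u v)].
pose P0 := [set q : sgraph n * ('I_n * 'I_n) | (q.1 \in R0) &&
  ((q.2.1 \in neighbours q.1 u) && (q.2.2 \in neighbours q.1 v))].
pose f (q : sgraph n * ('I_n * 'I_n)) := (switch q.1 u v q.2.1 q.2.2, q.2).
apply: (@leq_trans #|P1|).
  rewrite -sum_nat_const -[leqRHS]sum1_card.
  rewrite (eq_bigl (fun q => (q.1 \in R1) && (q.2 \in switchable q.1 F u v))); last first.
    by move=> q; rewrite inE.
  rewrite -(pair_big_dep (mem R1) (fun G p => p \in switchable G F u v) (fun _ _ => 1)) /=.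
  apply: leq_sum => G; rewrite inE => /andP[rG _]; rewrite sum1_card.
  by rewrite leq_subLR addnC; exact: card_switchable.
apply: (@leq_trans #|P0|); last first.
  rewrite mulnC -sum_nat_const -[leqLHS]sum1_card.
  rewrite (eq_bigl (fun q => (q.1 \in R0) && (q.2 \in
     setX (neighbours q.1 u) (neighbours q.1 v)))); last first.
    by case=> G [x y]; rewrite !inE.
  rewrite -(pair_big_dep (mem R0)
     (fun G p => p \in setX (neighbours G u) (neighbours G v)) (fun _ _ => 1)) /=.
  apply: leq_sum => G; rewrite inE => /andP[rG _].
  by rewrite sum1_card cardsX !(regular_neighbours _ rG).
have finj : {in P1 &, injective f}.
  move=> [G [x y]] [G' [x' y']]; rewrite inE => /andP[/= GR sG].
  rewrite inE => /andP[/= GR' sG'] [] eG ex ey; move: sG' eG; rewrite -{}ex -{}ey => sG' eG.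
  have [_ _ _ E] := switchP uv uvF GR sG.
  have [_ _ _ E'] := switchP uv uvF GR' sG'.
  by congr (_, _); apply: val_inj; rewrite /= E E' eG.
rewrite -(card_in_imset finj); apply: subset_leq_card.
apply/subsetP => _ /imsetP[[G [x y]] + ->]; rewrite inE => /andP[/= GR sG].
have [h1 h2 h3 _] := switchP uv uvF GR sG.
by rewrite inE /= h1 h2 h3.
Qed.

(** In probabilistic terms, the edges of [F] are jointly present with
    probability at most [(2 * d / n) ^ #|F|].  The edges are removed one at a
    time; the assumption on [#|F|] keeps at least half of all oriented edges
    available for switching. *)
Lemma card_regular_with_le n d (F : {set {set 'I_n}}) :
  4 * #|F| + 4 * d + 4 * d ^ 2 <= n * d ->
  #|regular_with d F| * n ^ #|F| <= (2 * d) ^ #|F| * #|regular_with d (set0 : {set {set 'I_n}})|.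
Proof.
have [m] := ubnP #|F|; elim: m F => // m IH F; rewrite ltnS => Fm Fn.
have [->|[e eF]] := set_0Vmem F; first by rewrite cards0 !expn0 muln1 mul1n.
have cF : #|F| = #|F :\ e|.+1 by rewrite (cardsD1 e F) eF.
have {}IH := IH (F :\ e).
have [e2|e2] := boolP (#|e| == 2); last first.
  rewrite (_ : regular_with d F = set0) ?cards0 //; apply/setP => G; rewrite !inE.
  apply/negP => /andP[_ /subsetP/(_ e eF)/card_edge e2']; by rewrite e2' in e2.
have /cards2P[u [v [uv eE]]] := e2.
have := @card_regular_with_switch n d (F :\ e) u v uv.
rewrite -eE !inE eqxx /= setD1K // => /(_ isT) S.
have {}IH : #|regular_with d (F :\ e)| * n ^ #|F :\ e| <=
    (2 * d) ^ #|F :\ e| * #|regular_with d (set0 : {set {set 'I_n}})|.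
  by apply: IH; lia.
rewrite cF !expnS; move: IH S; set a := #|regular_with d F|.
set b := #|regular_with d (F :\ e)|; set r := #|regular_with d set0|.
set N := n ^ _; set D := (2 * d) ^ _ => IH S.
have d0 : 0 < d \/ d = 0 by lia.
have S' : a * n <= 2 * d * b.
  case: d0 => [d0|d0]; last by subst d; lia.
  have : a * (n * d) <= 2 * d ^ 2 * b.
    apply: (@leq_trans (a * (2 * (n * d - (2 * #|F :\ e| + 2 * d + 2 * d ^ 2))))).
      by rewrite leq_mul2l; apply/orP; right; lia.
    by rewrite mulnCA -mulnA leq_mul2l S orbT.
  rewrite -(leq_pmul2r d0); nia.
apply: (@leq_trans (2 * d * b * N)); first by rewrite mulnA leq_mul2r S' orbT.
by rewrite -!mulnA leq_mul2l leq_mul2l IH !orbT.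
Qed.

End Switching.

(** * Sparsity of random regular graphs *)

Section Sparsity.
Import boot.fintype boot.finset.
Local Open Scope set_scope.
Local Open Scope nat_scope.

Lemma card_union_bound (I T : finType) (P : {set I}) (B : I -> {set T})
    (A : {set T}) :
  (forall x, x \in A -> exists2 i, i \in P & x \in B i) ->
  #|A| <= \sum_(i in P) #|B i|.
Proof.
move=> AB; apply: (@leq_trans #|\bigcup_(i in P) B i|).
  apply: subset_leq_card; apply/subsetP => x /AB[i iP xB].
  by apply/bigcupP; exists i.
elim/big_rec2: _ => [|i k A' _ IH]; first by rewrite cards0.
by rewrite (leq_trans (leq_card_setU _ _).1) // leq_add2l.
Qed.

Lemma bin_le_expn n k : 'C(n, k) <= 2 ^ n.
Proof.
rewrite -{1}(card_ord n) -card_draws; apply: leq_trans (max_card _) _.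
by rewrite -cardsT -powersetT card_powerset cardsT card_ord.
Qed.

(** The binomial coefficient of [k] among [2 * k] is at most [4 ^ k], and
    multiplied by [k`!] it is the product of [k + 1, ..., 2 * k]. *)
Lemma expnn_le_fact k : k ^ k <= 4 ^ k * k`!.
Proof.
apply: (@leq_trans ('C(2 * k, k) * k`!)); last first.
  by rewrite leq_mul2r (_ : 4 ^ k = 2 ^ (2 * k)) ?bin_le_expn ?orbT // expnM.
rewrite bin_ffact ffact_prod -[X in _ ^ X <= _](card_ord k) -prod_nat_const.
by apply: leq_prod => i _; have := ltn_ord i; lia.
Qed.

Definition inner_edges n (G : sgraph n) (S : {set 'I_n}) :=
  [set e in edges G | e \subset S].

Definition sparse n (q M : nat) (G : sgraph n) : bool :=
  [forall S : {set 'I_n},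
    (#|S| * M <= n) ==> (#|inner_edges G S| * q <= q.+1 * #|S|)].

(** With this scale the terms of the union bound below decrease geometrically. *)
Definition sparsity_scale (d q : nat) : nat := (128 * d) ^ q * (8 * d).

Lemma exists_subset_card (T : finType) (B : {set T}) m : m <= #|B| ->
  exists2 F : {set T}, F \subset B & #|F| = m.
Proof.
move=> mB; have : 0 < #|[set F : {set T} | F \subset B & #|F| == m]|.
  by rewrite cards_draws bin_gt0.
by case/card_gt0P => F; rewrite inE => /andP[FB /eqP Fm]; exists F.
Qed.

Lemma bin_expn n k : 'C(n, k) * k ^ k <= (4 * n) ^ k.
Proof.
have h1 := expnn_le_fact k.
have h2 : 'C(n, k) * k`! <= n ^ k.
  rewrite bin_ffact ffact_prod -[X in _ <= _ ^ X](card_ord k) -prod_nat_const.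
  by apply: leq_prod => i _; rewrite leq_subr.
rewrite expnMn; apply: leq_trans (_ : 'C(n, k) * (4 ^ k * k`!) <= _).
  by rewrite leq_mul2l h1 orbT.
by rewrite mulnCA leq_mul2l h2 orbT.
Qed.

Lemma card_many_inner_edges n d k m (S : {set 'I_n}) : #|S| = k ->
  4 * m + 4 * d + 4 * d ^ 2 <= n * d ->
  #|[set G : sgraph n | regular d G && (m <= #|inner_edges G S|)]| * n ^ m
    <= 'C(k ^ 2, m) * (2 * d) ^ m * #|[set G : sgraph n | regular d G]|.
Proof.
move=> Sk mn; pose pairs := [set e : {set 'I_n} | (e \subset S) & #|e| == 2].
pose P := [set F : {set {set 'I_n}} | F \subset pairs & #|F| == m].
have bound F : F \in P -> #|regular_with d F| * n ^ m <=
    (2 * d) ^ m * #|[set G : sgraph n | regular d G]|.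
  rewrite inE => /andP[_ /eqP Fm]; have := @card_regular_with_le n d F.
  rewrite Fm => /(_ mn) h; apply: leq_trans h _; rewrite leq_mul2l; apply/orP; right.
  by apply: subset_leq_card; apply/subsetP => G; rewrite !inE => /andP[].
have cP : #|P| <= 'C(k ^ 2, m).
  rewrite cards_draws leq_bin2l // cards_draws Sk bin2 -divn2.
  by rewrite (leq_trans (leq_div _ _)) // expnS expn1 leq_mul2l leq_pred orbT.
apply: (@leq_trans ((\sum_(F in P) #|regular_with d F|) * n ^ m)).
  rewrite leq_mul2r; apply/orP; right; apply: card_union_bound => G.
  rewrite inE => /andP[rG /exists_subset_card[F FG Fm]]; exists F.
    rewrite inE Fm eqxx andbT; apply: subset_trans FG _; apply/subsetP => e.
    by rewrite !inE => /andP[/card_edge-> ->].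
  rewrite inE rG; apply: subset_trans FG _; apply/subsetP => e.
  by rewrite !inE => /andP[].
rewrite big_distrl /= -mulnA.
set c := (2 * d) ^ m * _ in bound *.
apply: (@leq_trans (\sum_(F in P) c)); first exact: leq_sum.
by rewrite sum_nat_const leq_mul2r cP orbT.
Qed.

(** A set of [k] vertices violates the condition of [sparse] when it spans at
    least [m = k + k %/ q + 1] edges.  The union bound over these
    vertex sets and over the sets of [m] pairs inside them gives a term
    [B ^ k * (k / n) ^ (m - k)], up to constants.  As [m - k] is at least
    [k / q], the power of [B] is absorbed when [k / n] is small; as [m - k] is
    at least [1], a factor [1 / n] is left over. *)
Lemma card_dense_of_size n d q k :
  2 < d -> 0 < q -> 8 * d.+1 <= n -> 0 < k -> k * sparsity_scale d q <= n ->
  2 ^ k * n * #|[set G : sgraph n | regular d G &&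
    [exists S : {set 'I_n}, (#|S| == k) && (k + (k %/ q).+1 <= #|inner_edges G S|)]]|
   <= sparsity_scale d q * #|[set G : sgraph n | regular d G]|.
Proof.
set M := sparsity_scale d q.
move=> d2 q0 nd k0 kM; set m := k + (k %/ q).+1; set i := k %/ q in m *.
set r := #|[set G : sgraph n | regular d G]|; set bad := #|_|.
have n0 : 0 < n by lia.
have kqi : k <= q * i.+1.
  by rewrite {1}(divn_eq k q) mulnC mulnS addnC leq_add2r ltnW // ltn_pmod.
have ik : i <= k by rewrite leq_div.
have M24 : 24 <= M.
  have : 0 < (128 * d) ^ q by rewrite expn_gt0; lia.
  rewrite /M /sparsity_scale; nia.
have mn : 4 * m + 4 * d + 4 * d ^ 2 <= n * d.
  have : 24 * k <= n by apply: leq_trans kM; rewrite mulnC leq_mul2l M24 orbT.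
  have : m <= 3 * k by rewrite /m; lia.
  nia.
have main : bad * n ^ m <= 'C(n, k) * ('C(k ^ 2, m) * (2 * d) ^ m * r).
  pose P := [set S : {set 'I_n} | #|S| == k].
  pose B (S : {set 'I_n}) := [set G : sgraph n | regular d G && (m <= #|inner_edges G S|)].
  apply: (@leq_trans ((\sum_(S in P) #|B S|) * n ^ m)).
    rewrite leq_mul2r; apply/orP; right; apply: card_union_bound => G.
    rewrite inE => /andP[rG /existsP[S /andP[Sk Sm]]]; exists S; rewrite inE //.
    by rewrite rG.
  rewrite -[X in 'C(X, _)](card_ord n) -card_draws -sum_nat_const big_distrl /=.
  apply: leq_sum => S; rewrite inE => /eqP Sk.
  exact: card_many_inner_edges Sk mn.
have bin1 : 'C(n, k) * k ^ k <= (4 * n) ^ k := bin_expn n k.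
have m0 : 0 < m by rewrite /m; lia.
have bin2 : 'C(k ^ 2, m) <= (4 * k) ^ m.
  rewrite -(@leq_pmul2r (k ^ m)) ?expn_gt0 ?k0 //.
  apply: (@leq_trans ('C(k ^ 2, m) * m ^ m)).
    by rewrite leq_mul2l leq_exp2r // leq_addr orbT.
  apply: leq_trans (bin_expn _ _) _.
  by rewrite -expnMn leq_exp2r // -mulnA mulnn.
have nm0 : 0 < n ^ m by rewrite expn_gt0 n0.
have kk0 : 0 < k ^ k by rewrite expn_gt0 k0.
have step : bad * n ^ m * k ^ k <= (4 * n) ^ k * ((8 * d * k) ^ m * r).
  apply: (@leq_trans ('C(n, k) * ('C(k ^ 2, m) * (2 * d) ^ m * r) * k ^ k)).
    by rewrite leq_mul2r main orbT.
  rewrite mulnAC; apply: leq_mul => //; rewrite leq_mul2r; apply/orP; right.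
  rewrite (_ : 8 * d * k = 4 * k * (2 * d)); last by lia.
  by rewrite (expnMn (4 * k)) leq_mul2r bin2 orbT.
have expn_le a : 0 < a -> a ^ k <= (a ^ q) ^ i.+1.
  by move=> a0; rewrite -expnM leq_pexp2l.
(* What remains of the estimate once the powers of n and k are cancelled. *)
have num : 8 ^ k * (8 * d) ^ m * k ^ i.+1 <= M * n ^ i.
  apply: (@leq_trans (M * (k * M) ^ i)); last first.
    rewrite leq_mul2l; case: (i) => [|i']; first by rewrite !expn0 leqnn orbT.
    by rewrite leq_exp2r // kM orbT.
  have -> : M * (k * M) ^ i = k ^ i * M ^ i.+1.
    by rewrite (expnMn k) mulnCA -expnS.
  have -> : 8 ^ k * (8 * d) ^ m * k ^ i.+1 =
      k ^ i * (8 ^ k * (8 * d) ^ k * k * (8 * d) ^ i.+1).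
    rewrite (expnS k) (_ : (8 * d) ^ m = (8 * d) ^ k * (8 * d) ^ i.+1); last by rewrite -expnD.
    move: (8 ^ k) ((8 * d) ^ k) ((8 * d) ^ i.+1) (k ^ i) => a b c e; lia.
  rewrite leq_mul2l /M /sparsity_scale (expnMn _ (8 * d)) leq_mul2r.
  apply/orP; right; apply/orP; right.
  apply: leq_trans (expn_le (128 * d) _); last by lia.
  apply: (@leq_trans (8 ^ k * (8 * d) ^ k * 2 ^ k)).
    by rewrite leq_mul2l ltnW ?orbT // ltn_expl.
  by rewrite -!expnMn leq_exp2r //; lia.
rewrite -(leq_pmul2r nm0) -(leq_pmul2r kk0).
apply: (@leq_trans (2 ^ k * n * ((4 * n) ^ k * ((8 * d * k) ^ m * r)))).
  apply: (@leq_trans (2 ^ k * n * (bad * n ^ m * k ^ k))); first by rewrite !mulnA.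
  by rewrite leq_mul2l step orbT.
have em : n ^ m = n ^ k * (n * n ^ i) by rewrite -expnS -expnD.
have ek : k ^ m = k ^ k * k ^ i.+1 by rewrite -expnD.
have e8 : 8 ^ k = 2 ^ k * 4 ^ k by rewrite -expnMn.
rewrite em (expnMn _ k) ek (expnMn 4) e8 in num *.
set A := 2 ^ k in num *; set B := 4 ^ k in num *; set C := (8 * d) ^ m in num *.
set D := k ^ i.+1 in num *; set E := n ^ i in num *; set K := k ^ k; set N := n ^ k.
rewrite [leqLHS](_ : _ = (n * N * K * r) * (A * B * C * D)); last by lia.
rewrite [leqRHS](_ : _ = (n * N * K * r) * (M * E)); last by lia.
by rewrite leq_mul2l num orbT.
Qed.

Lemma sum_expn2_le n : \sum_(1 <= k < n.+1) 2 ^ (n - k) <= 2 ^ n.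
Proof.
rewrite -(leq_add2r 1) (_ : _ + 1 = 2 ^ n) ?leq_addr //.
elim: n => [|n IH]; first by rewrite big_geq.
rewrite big_nat_recr //= subnn expn0 expnS -IH mul2n -addnn.
rewrite (eq_big_nat _ _ (F2 := fun k => 2 * 2 ^ (n - k))) => [|k /andP[_ kn]].
  by rewrite -big_distrr /=; lia.
by rewrite -expnS subSn.
Qed.

(** The violations by sets of size [k] have probability at most [2 ^ - k]
    times the scale divided by [n]. *)
Lemma card_not_sparse n d q :
  2 < d -> 0 < q -> 8 * d.+1 <= n ->
  n * #|[set G : sgraph n | regular d G && ~~ sparse q (sparsity_scale d q) G]|
    <= sparsity_scale d q * #|[set G : sgraph n | regular d G]|.
Proof.
set M := sparsity_scale d q.
move=> d2 q0 nd; set r := #|[set G : sgraph n | regular d G]|.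
pose B k := [set G : sgraph n | [&& k * M <= n, regular d G &
    [exists S : {set 'I_n}, (#|S| == k) && (k + (k %/ q).+1 <= #|inner_edges G S|)]]].
have bound k : 0 < k -> 2 ^ k * n * #|B k| <= M * r.
  move=> k0; have [kM|kM] := leqP (k * M) n; last first.
    rewrite (_ : B k = set0) ?cards0 ?muln0 //; apply/setP => G; rewrite !inE.
    by rewrite leqNgt kM.
  apply: leq_trans (card_dense_of_size d2 q0 nd k0 kM); rewrite leq_mul2l.
  apply/orP; right; apply: subset_leq_card; apply/subsetP => G.
  by rewrite !inE => /andP[_].
have U : #|[set G : sgraph n | regular d G && ~~ sparse q M G]| <=
    \sum_(1 <= k < n.+1) #|B k|.
  rewrite big_add1 /= big_mkord.
  rewrite (eq_bigl (fun k => k \in [set: 'I_n])); last by move=> k; rewrite inE.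
  apply: card_union_bound => G; rewrite inE => /andP[rG /forallPn[S]].
  rewrite negb_imply -ltnNge => /andP[kM dense].
  have k0 : 0 < #|S|.
    rewrite lt0n; apply: contraTneq dense => /eqP; rewrite cards_eq0 => /eqP ->.
    rewrite cards0 muln0 -leqNgt leqn0 muln_eq0 cards_eq0 -subset0; apply/orP; left.
    apply/subsetP => e; rewrite inE subset0 => /andP[/card_edge + /eqP e0].
    by rewrite e0 cards0.
  have kn : #|S|.-1 < n.
    by rewrite prednK //; have := max_card S; rewrite card_ord.
  exists (Ordinal kn); first by rewrite inE.
  rewrite inE /= prednK // kM rG; apply/existsP; exists S; rewrite eqxx /=.
  rewrite addnS ltnNge; apply: contraL dense => few; rewrite -leqNgt.
  apply: leq_trans (leq_mul few (leqnn q)) _.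
  by rewrite mulnDl mulSn mulnC addnC leq_add2r leq_divM.
rewrite -(@leq_pmul2l (2 ^ n)) ?expn_gt0 //.
apply: (@leq_trans (\sum_(1 <= k < n.+1) 2 ^ n * n * #|B k|)).
  by rewrite -big_distrr /= mulnA leq_mul2l U orbT.
apply: (@leq_trans (\sum_(1 <= k < n.+1) 2 ^ (n - k) * (M * r))).
  rewrite big_nat [leqRHS]big_nat; apply: leq_sum => k /andP[k0 kn].
  rewrite -{1}(subnK (n := n) (m := k)) // expnD.
  rewrite (_ : _ * n * _ = 2 ^ (n - k) * (2 ^ k * n * #|B k|)); last by rewrite !mulnA.
  by rewrite leq_mul2l bound ?orbT.
by rewrite -big_distrl /= leq_mul2r sum_expn2_le orbT.
Qed.

End Sparsity.

(** * Existence of regular graphs *)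

Section Existence.
Import boot.fintype boot.finset.
Local Open Scope set_scope.
Local Open Scope ring_scope.

(** The Cayley graph of the integers modulo [n.+1] for the connection set [S]. *)
Definition circulant_edges n (S : {set 'I_n.+1}) : {set {set 'I_n.+1}} :=
  [set e | [exists x, exists s in S, e == [set x; x + s]]].

Lemma circulant_edges_card n (S : {set 'I_n.+1}) : 0 \notin S ->
  [forall e in circulant_edges S, #|e| == 2%N].
Proof.
move=> S0; apply/forallP => e; apply/implyP; rewrite inE.
case/existsP => x /existsP[s /andP[sS /eqP ->]]; rewrite cards2.
suff -> : x != x + s by [].
by apply: contraNneq S0 => xs; rewrite -[0](addrN x) {1}xs addrC addKr.
Qed.

Lemma circulant_regular n (S : {set 'I_n.+1}) (S0 : 0 \notin S) :
  (forall s, s \in S -> - s \in S) ->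
  regular #|S| (SGraph (circulant_edges_card S0)).
Proof.
move=> Sopp; apply/forallP => v; apply/eqP.
rewrite (_ : [set e in _ | _] = [set [set v; v + s] | s in S]).
  by rewrite card_imset // => s s' /set2_injr /addrI.
apply/setP => e; rewrite !inE /=; apply/andP/imsetP => [[]|[s sS ->]].
  case/existsP => x /existsP[s /andP[sS /eqP ->]].
  rewrite !inE => /orP[]/eqP ->; first by exists s.
  by exists (- s); rewrite ?Sopp // addrK setUC.
rewrite set21; split=> //; apply/existsP; exists v; apply/existsP; exists s.
by rewrite sS eqxx.
Qed.

(** Adding pairs [s, - s] changes the size by two.  The only nonzero element
    that can equal its opposite is the half of [n.+1], which starts the
    construction when [d] is odd and is avoided later on. *)
Lemma symmetric_set_exists n d : (d <= n)%N -> ~~ odd (n.+1 * d) ->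
  exists S : {set 'I_n.+1}, [/\ 0 \notin S, forall s, s \in S -> - s \in S & #|S| = d].
Proof.
have [m] := ubnP d; elim: m d => // m IH [|[|d]] dm dn nd.
- by exists set0; split; rewrite ?inE ?cards0 // => s; rewrite inE.
- have n2 : (n.+1./2 < n.+1)%N by lia.
  exists [set Ordinal n2]; split; rewrite ?cards1 ?inE //.
    by rewrite -val_eqE /=; lia.
  by move=> s; rewrite !inE => /eqP ->; rewrite -val_eqE /= modn_small; lia.
have [|||S [S0 Sopp Sd]] := IH d; [lia|lia|lia|].
have [s sP] : exists s, s \in ~: ((inord n.+1./2) |: (0 |: S)).
  apply/card_gt0P; have := cardsC (inord n.+1./2 |: (0 |: S)).
  rewrite card_ord !cardsU1 Sd; case: (_ \notin _); case: (_ \notin _); lia.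
move: sP; rewrite !inE !negb_or => /and3P[s2 s0 sS].
have sN : - s \notin S by apply: contra sS => /Sopp; rewrite opprK.
have ss : s != - s.
  have sn := ltn_ord s; have s_gt0 : (0 < s)%N by rewrite lt0n; move: s0; rewrite -val_eqE.
  apply: contra s2; rewrite -!val_eqE /= inordK; last by lia.
  by rewrite modn_small; lia.
exists (s |: (- s |: S)); split.
- by rewrite !inE !negb_or eq_sym s0 S0 andbT eq_sym oppr_eq0.
- move=> t; rewrite !inE => /or3P[/eqP->|/eqP->|/Sopp ->]; rewrite ?opprK ?eqxx ?orbT //.
- by rewrite !cardsU1 !inE negb_or ss sS sN Sd.
Qed.

Lemma regular_exists n d : (d < n)%N -> ~~ odd (n * d) ->
  (0 < #|[set G : sgraph n | regular d G]|)%N.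
Proof.
case: n => // n; rewrite ltnS => dn nd; have [S [S0 Sopp <-]] := symmetric_set_exists dn nd.
apply/card_gt0P; exists (SGraph (circulant_edges_card S0)).
by rewrite inE circulant_regular.
Qed.

End Existence.

(** * Cycles and transpositions *)

Section Cycles.
Import boot.fintype boot.finset.
Local Open Scope set_scope.
Local Open Scope nat_scope.

(** [porbits_mul_tperm] multiplies by the transposition on the other side;
    inverting permutations exchanges the sides and preserves the cycles. *)
Lemma cycle_number_mul_tperm n (s : 'S_n) x y : x != y ->
  cycle_number (s * tperm x y)%g + (y \notin porbit s x).*2 = (cycle_number s).+1.
Proof.
move=> xy; have := porbits_mul_tperm s^-1%g x y.
rewrite xy addn1 porbitsV /cycle_number.
rewrite -(porbitsV (s * _)%g) invMg tpermV => <-.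
by rewrite porbitV porbit_sym.
Qed.

Lemma cycle_number_le n (s : 'S_n) : cycle_number s <= n.
Proof.
by rewrite /cycle_number -[leqRHS]card_ord; apply: leq_imset_card.
Qed.

(** Ordering the ends of each edge gives the index set of [jump_rate]. *)
Definition edge_pairs n (G : sgraph n) : {set 'I_n * 'I_n} :=
  [set p : 'I_n * 'I_n | (p.1 < p.2) && ([set p.1; p.2] \in edges G)].

Definition internal_pairs n (G : sgraph n) (s : 'S_n) : {set 'I_n * 'I_n} :=
  [set p in edge_pairs G | p.2 \in porbit s p.1].

Lemma card_edge_pairs n d (G : sgraph n) : regular d G ->
  #|edge_pairs G|.*2 = n * d.
Proof.
move=> rG; rewrite -(card_regular_pairs rG).
pose swap (p : 'I_n * 'I_n) := (p.2, p.1).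
have swapI : injective swap by move=> [a b] [a' b'] [-> ->].
rewrite -addnn -{2}(card_imset (mem (edge_pairs G)) swapI) -cardsUI.
rewrite [X in _ + #|pred_of_set X|](_ : _ = set0) ?cards0 ?addn0.
  apply: eq_card => -[x y]; rewrite !inE /=; apply/orP/idP => [[/andP[]//|]|xyG].
    by case/imsetP => -[a b]; rewrite inE /= => /andP[_ abG] [-> ->]; rewrite setUC.
  have := edge_neq xyG; rewrite neq_ltn => /orP[xy|yx]; first by left; rewrite xy.
  by right; apply/imsetP; exists (y, x); rewrite // inE /= yx setUC.
apply/setP => -[x y]; rewrite !inE /=; apply/negP => /andP[/andP[xy _]].
case/imsetP => -[a b]; rewrite inE /= => /andP[ab _] [xb ya].
by rewrite xb ya ltnNge (ltnW ab) in xy.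
Qed.

Lemma card_internal_pairs_le n (G : sgraph n) s :
  #|internal_pairs G s| <= #|edge_pairs G|.
Proof. by apply: subset_leq_card; apply/subsetP => p; rewrite inE => /andP[]. Qed.

Lemma sum_card_porbits n (s : 'S_n) : \sum_(C in porbits s) #|C| = n.
Proof.
rewrite -[RHS]card_ord -sum1_card.
rewrite (partition_big (porbit s) (mem (porbits s))) => [|x _] /=; last exact: imset_f.
apply: eq_bigr => _ /imsetP[z _ ->]; rewrite sum1_card; apply: eq_card => x.
by rewrite -eq_porbit_mem.
Qed.

Lemma card_internal_pairs n (G : sgraph n) s :
  #|internal_pairs G s| <= \sum_(C in porbits s) #|inner_edges G C|.
Proof.
rewrite -sum1_card (partition_big (fun p => porbit s p.1) (mem (porbits s))) /=; last first.
  by move=> p _; apply: imset_f.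
apply: leq_sum => C _; rewrite sum1dep_card; set A := [set p | _].
pose toe (p : 'I_n * 'I_n) := [set p.1; p.2].
have toeI : {in [set p in edge_pairs G | porbit s p.1 == C] &, injective toe}.
  move=> [a b] [a' b']; rewrite !inE /= => /andP[/andP[ab _] _] /andP[/andP[ab' _] _].
  move=> /set2_inj[[/= -> ->]//|[/= h1 h2]].
  by rewrite h1 h2 ltnNge (ltnW ab') in ab.
rewrite -(@card_in_imset _ _ toe (mem A)); last first.
  move=> p p' pA pA'; apply: toeI; [move: pA|move: pA'];
  by rewrite !inE => /andP[/andP[/andP[-> ->] _] ->].
apply: subset_leq_card; apply/subsetP => _ /imsetP[p pA ->].
move: pA; rewrite !inE => /andP[/andP[/andP[_ eG] pp] /eqP <-].
by rewrite eG subUset !sub1set porbit_id.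
Qed.

Lemma sparse_internal_pairs n q M (G : sgraph n) s : sparse q M G ->
  (forall C, C \in porbits s -> #|C| * M <= n) ->
  #|internal_pairs G s| * q <= q.+1 * n.
Proof.
move=> /forallP sG small.
apply: (@leq_trans ((\sum_(C in porbits s) #|inner_edges G C|) * q)).
  by rewrite leq_mul2r card_internal_pairs orbT.
rewrite -[in leqRHS](sum_card_porbits s) big_distrl big_distrr /=.
by apply: leq_sum => C Cs; have /implyP := sG C; apply; apply: small.
Qed.

End Cycles.

(** * Uniform right derivatives *)

Section RightDerivative.
Local Open Scope classical_set_scope.
Local Open Scope ring_scope.

Definition uniform_right_derivative (R : realType) (F g : R -> R) :=
  forall e : R, 0 < e -> exists2 r : R, 0 < r &
    forall t h, 0 <= t -> 0 < h < r -> `|F (t + h) - F t - h * g t| <= e * h.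

(** The process is only prescribed at nonnegative times; freezing [F] at [F 0] on
    the negative axis gives functions that can be continuous on the whole line. *)
Definition clip (R : realType) (F : R -> R) (t : R) : R := F (Num.max t 0).

(** A bounded uniform right derivative makes [F] locally Lipschitz. *)
Lemma clip_continuous (R : realType) (F g : R -> R) (B : R) :
  uniform_right_derivative F g -> (forall t, 0 <= t -> `|g t| <= B) ->
  continuous (clip F).
Proof.
move=> Fg gB; have B0 : 0 <= B by apply: le_trans (gB 0 (lexx _)).
have [r r0 hr] := Fg 1 ltr01.
have lip_lt a b : 0 <= a -> a < b -> b - a < r -> `|F b - F a| <= (1 + B) * (b - a).
  move=> a0 ab abr; have := hr a (b - a) a0; rewrite subr_gt0 ab abr => /(_ isT).
  rewrite (_ : a + (b - a) = b) => [h|]; last by ring.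
  rewrite -[F b - F a](subrK ((b - a) * g a)); apply: le_trans (ler_normD _ _) _.
  rewrite (_ : (1 + B) * _ = 1 * (b - a) + B * (b - a)); last by ring.
  rewrite lerD // normrM (@gtr0_norm _ (b - a)) ?subr_gt0 //.
  by rewrite mulrC ler_wpM2r ?gB // subr_ge0 ltW.
have lip a b : 0 <= a -> 0 <= b -> `|b - a| < r -> `|F b - F a| <= (1 + B) * `|b - a|.
  move=> a0 b0; have [ab|ba|->] := ltgtP a b.
  - by rewrite gtr0_norm ?subr_gt0 //; exact: lip_lt.
  - by rewrite distrC (distrC (F b)) gtr0_norm ?subr_gt0 //; exact: lip_lt.
  - by rewrite !subrr normr0 mulr0.
have maxl (x y : R) : `|Num.max x 0 - Num.max y 0| <= `|x - y|.
  have h1 := ler_norm (x - y); have h2 := ler_norm (y - x); rewrite distrC in h2.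
  by rewrite ler_norml; case: (leP x 0) => ?; case: (leP y 0) => ?; apply/andP; split; lra.
move=> x; apply/cvgrPdist_le => e e0.
near=> y.
have xyr : `|x - y| < r by near: y; apply: cvgr_dist_lt.
have xye : `|x - y| < e / (1 + B).
  by near: y; apply: cvgr_dist_lt => //; rewrite divr_gt0 // ltr_pwDl.
apply: le_trans (lip _ _ _ _ _) _; rewrite ?le_max ?lexx ?orbT //.
  exact: le_lt_trans (maxl _ _) xyr.
rewrite mulrC -ler_pdivlMr ?ltr_pwDl //.
exact: le_trans (maxl _ _) (ltW xye).
Unshelve. all: by end_near.
Qed.

(** For the left derivative at [x], the uniform estimate is used at the base
    point [x + h < x], where [g] is close to [g x] by continuity. *)
Lemma clip_is_derive (R : realType) (F g : R -> R) (x : R) :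
  uniform_right_derivative F g -> {for x, continuous (clip g)} -> 0 < x ->
  is_derive x 1 (clip F) (g x).
Proof.
move=> Fg gx x0.
have clipE (f : R -> R) y : 0 <= y -> clip f y = f y by move=> y0; rewrite /clip max_l.
suff lim : h^-1 *: (clip F (h *: 1 + x) - clip F x) @[h --> 0^'] --> g x.
  apply: DeriveDef; first by apply/cvg_ex; exists (g x).
  exact: cvg_lim lim.
apply/cvgrPdist_le => e e0; have e20 : 0 < e / 2 by rewrite divr_gt0.
have [r r0 hr] := Fg _ e20.
have gx' : \forall h \near 0^', `|clip g x - clip g (h + x)| <= e / 2.
  have shift : h + x @[h --> 0^'] --> x.
    rewrite -[X in _ --> X]add0r; apply: cvgD; last exact: cvg_cst.
    by apply: cvg_within_filter; exact: cvg_id.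
  have /cvgrPdist_le/(_ _ e20) := cvg_comp _ _ shift gx.
  exact.
near=> h.
have h0 : h != 0 by near: h; exact: nbhs_dnbhs_neq.
have hx : `|h| < x by near: h; apply: dnbhs0_lt.
have hhr : `|h| < r by near: h; apply: dnbhs0_lt.
have hg : `|clip g x - clip g (h + x)| <= e / 2 by near: h.
have hx0 : 0 < h + x by move: hx; rewrite ltr_norml => /andP[]; lra.
move: hg; rewrite [h *: 1]mulr1 !clipE ?(ltW hx0) ?(ltW x0) // => hg.
have [hneg|hpos] := ltP h 0.
  have := hr (h + x) (- h) (ltW hx0); rewrite oppr_gt0 hneg -(ltr0_norm hneg) hhr.
  move=> /(_ isT); rewrite (ltr0_norm hneg) [h + x - h]addrC addrA addNr add0r => hh.
  rewrite -(@ler_pM2r _ `|h|) ?normr_gt0 // -normrM mulrBl.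
  rewrite (_ : h^-1 *: _ * h = F (h + x) - F x); last first.
    by rewrite /GRing.scale /= mulrC mulrA divff ?mul1r.
  rewrite [e](_ : _ = e / 2 + e / 2); last by lra.
  rewrite (_ : _ - _ = (F x - F (h + x) - - h * g (h + x)) + h * (g x - g (h + x))); last by ring.
  apply: le_trans (ler_normD _ _) _; rewrite mulrDl lerD //.
    by rewrite (ltr0_norm hneg).
  by rewrite normrM mulrC ler_wpM2r.
have {}hpos : 0 < h by rewrite lt_neqAle eq_sym h0.
have := hr x h (ltW x0); rewrite hpos -(gtr0_norm hpos) hhr.
move=> /(_ isT); rewrite (gtr0_norm hpos) => hh.
rewrite -(@ler_pM2r _ `|h|) ?normr_gt0 // -normrM mulrBl.
rewrite (_ : h^-1 *: _ * h = F (h + x) - F x); last first.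
  by rewrite /GRing.scale /= mulrC mulrA divff ?mul1r.
rewrite (_ : _ - _ = - (F (x + h) - F x - h * g x)); last by rewrite (addrC h); ring.
rewrite normrN (gtr0_norm hpos); apply: le_trans hh _.
by rewrite ler_wpM2r ?(ltW hpos) //; lra.
Unshelve. all: by end_near.
Qed.

End RightDerivative.

(** * Means of the interchange process *)

Section FiniteExpectation.
Local Open Scope classical_set_scope.
Local Open Scope ring_scope.

Lemma expectation_finite_range (d : measure_display) (T : measurableType d)
    (R : realType) (P : probability T R) (S : finType) (Y : T -> S) (f : S -> R) :
  (forall s, measurable (Y @^-1` [set s])) ->
  ('E_P[fun w => f (Y w)] = (\sum_s f s * fine (P (Y @^-1` [set s])))%:E)%E.
Proof.
move=> mY; rewrite unlock.
under eq_integral => w _.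
  rewrite (_ : (f (Y w))%:E = \sum_s (f s)%:E * (\1_(Y @^-1` [set s]) w)%:E)%E; last first.
    rewrite (bigD1 (Y w)) //= indicE mem_set //= mule1 big1 ?adde0 // => s sY.
    by rewrite indicE memNset ?mule0 // => /= e; rewrite e eqxx in sY.
  over.
rewrite integral_sum //; last by move=> s; apply: integrableZl => //; exact: integrable_indic.
rewrite -sumEFin; apply: eq_bigr => s _.
rewrite integralZl ?integral_indic ?setIT //; last exact: integrable_indic.
by rewrite EFinM fineK // fin_num_measure.
Qed.

End FiniteExpectation.

Section Process.
Local Open Scope classical_set_scope.
Local Open Scope ring_scope.

Local Notation path X := (@ip_path _ _ _ X).

Definition law (R : realType) n (G : sgraph n) (X : interchange_process R G)
  (t : R) (s : 'S_n) : R := fine (ip_prob X (path X t @^-1` [set s])).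

Definition mean (R : realType) n (G : sgraph n) (X : interchange_process R G)
  (f : 'S_n -> R) (t : R) : R := \sum_s f s * law X t s.

Lemma law_ge0 (R : realType) n (G : sgraph n) (X : interchange_process R G) t s :
  0 <= law X t s.
Proof. by rewrite fine_ge0. Qed.

Lemma law_le1 (R : realType) n (G : sgraph n) (X : interchange_process R G) t s :
  0 <= t -> law X t s <= 1.
Proof.
move=> t0; have mA := ip_measurable X s t0; rewrite -lee_fin fineK ?fin_num_measure //.
exact: probability_le1.
Qed.

Lemma expectation_path (R : realType) n (G : sgraph n)
    (X : interchange_process R G) (f : 'S_n -> R) (t : R) : 0 <= t ->
  ('E_(ip_prob X)[fun w => f (path X t w)] = (mean X f t)%:E)%E.
Proof.
by move=> t0; apply: expectation_finite_range => s; exact: ip_measurable.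
Qed.

Lemma mean_cst (R : realType) n (G : sgraph n) (X : interchange_process R G)
  (c t : R) : 0 <= t -> mean X (fun=> c) t = c.
Proof.
move=> t0; have := expectation_path X (fun=> c) t0; rewrite expectation_cst.
by case.
Qed.

(** The Markov property with the whole space as event of the past. *)
Lemma law_step (R : realType) n (G : sgraph n) (X : interchange_process R G)
    (t h : R) s s' : 0 <= t -> 0 <= h ->
  fine (ip_prob X (path X t @^-1` [set s] `&` path X (t + h) @^-1` [set s']))
  = law X t s * ip_trans X h s s'.
Proof.
move=> t0 h0; have := @ip_markov _ _ _ X t h setT s s' t0 h0.
rewrite !setTI => ->; last first.
  (* The whole space is the event that the process starts at 1. *)
  apply: sub_gen_smallest; exists 0, 1%g; rewrite lexx t0; split=> //.
  by apply/seteqP; split=> w //= _; exact: ip_start.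
rewrite fineM // fin_num_measure //; exact: ip_measurable.
Qed.

Definition generator (R : realType) n (G : sgraph n) (f : 'S_n -> R) (s : 'S_n) : R :=
  \sum_(p in edge_pairs G) (f (s * tperm p.1 p.2)%g - f s).

Lemma generatorE (R : realType) n (G : sgraph n) (f : 'S_n -> R) (s : 'S_n) :
  generator G f s = \sum_s' (f s' - f s) * jump_rate R G s s'.
Proof.
have rateE s' : jump_rate R G s s' =
    \sum_(p in edge_pairs G) (s' == (s * tperm p.1 p.2)%g)%:R.
  by rewrite /jump_rate pair_big_dep; apply: eq_bigl => p; rewrite inE.
under eq_bigr do rewrite rateE mulr_sumr.
rewrite exchange_big /=; apply: eq_bigr => p _.
rewrite (bigD1 (s * tperm p.1 p.2)%g) //= eqxx mulr1 big1 ?addr0 // => s' /negbTE ->.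
by rewrite mulr0.
Qed.

(** Only off-diagonal transitions contribute, because [f s' - f s] vanishes on
    the diagonal. *)
Lemma mean_step (R : realType) n (G : sgraph n) (X : interchange_process R G)
    (f : 'S_n -> R) (t h : R) : 0 <= t -> 0 <= h ->
  mean X f (t + h) - mean X f t =
  \sum_s \sum_s' (f s' - f s) * (law X t s * ip_trans X h s s').
Proof.
move=> t0 h0; pose Y w := (path X t w, path X (t + h) w).
have th0 : 0 <= t + h by rewrite addr_ge0.
have YE s s' : Y @^-1` [set (s, s')] =
    path X t @^-1` [set s] `&` path X (t + h) @^-1` [set s'].
  by apply/seteqP; split=> w /=; rewrite /Y => -[-> ->].
have mY p : measurable (Y @^-1` [set p]).
  by case: p => s s'; rewrite YE; apply: measurableI; exact: ip_measurable.
have h1 := expectation_finite_range (ip_prob X) (fun p => f p.2) mY.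
have h2 := expectation_finite_range (ip_prob X) (fun p => f p.1) mY.
rewrite /= expectation_path // in h1; rewrite /= expectation_path // in h2.
case: h1 => ->; case: h2 => ->; rewrite -sumrB pair_bigA /=.
by apply: eq_bigr => -[s s'] _; rewrite YE law_step // -mulrBl.
Qed.

(** By [mean_step] the error is a combination of the errors in the convergence
    [ip_rate]; time enters its coefficients only through [law X t s <= 1], hence
    the uniformity. *)
Lemma mean_right_derivative (R : realType) n (G : sgraph n)
    (X : interchange_process R G) (f : 'S_n -> R) :
  uniform_right_derivative (mean X f) (mean X (generator G f)).
Proof.
move=> e e0.
(* A bound on the error divided by h. *)
pose err h := \sum_s \sum_(s' | s != s')
  `|f s' - f s| * `|ip_trans X h s s' / h - jump_rate R G s s'|.
have err0 : err h @[h --> 0^'+] --> 0.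
  rewrite -[0 in X in _ --> X](_ : \sum_(s : 'S_n) \sum_(s' : 'S_n | s != s') 0 = 0); last first.
    by rewrite big1 // => s _; rewrite big1.
  apply: cvg_big => [|s _]; first exact: add_continuous.
  apply: cvg_big => [|s' ss']; first exact: add_continuous.
  have c : `|ip_trans X h s s' / h - jump_rate R G s s'| @[h --> 0^'+] -->
      `|jump_rate R G s s' - jump_rate R G s s'|.
    by apply: cvg_norm; apply: cvgB; [exact: ip_rate|exact: cvg_cst].
  by have := cvgMr (a := `|f s' - f s|) c; rewrite subrr normr0 mulr0; apply.
have [r r0 hr] : exists2 r : R, 0 < r & forall h, 0 < h < r -> err h <= e.
  have /cvgrPdist_le/(_ e e0) := err0.
  rewrite near_withinE => -[r /= r0 hr]; exists r => // h /andP[h0 hr'].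
  have := hr h; rewrite /= !sub0r !normrN (gtr0_norm h0) => /(_ hr' h0).
  by apply: le_trans; exact: ler_norm.
exists r => // t h t0 hr'; have /andP[h0 _] := hr'.
rewrite mean_step ?(ltW h0) // /mean mulr_sumr -sumrB.
apply: le_trans (_ : err h * h <= _); last by rewrite ler_wpM2r ?(ltW h0) // hr.
rewrite /err mulr_suml; apply: le_trans (ler_norm_sum _ _ _) _.
apply: ler_sum => s _; rewrite generatorE [X in h * X]mulr_suml [X in _ - X]mulr_sumr -sumrB.
rewrite (bigD1 s) //= subrr !mul0r mulr0 subrr add0r mulr_suml.
apply: le_trans (ler_norm_sum _ _ _) _.
rewrite (eq_bigl (fun s' => s != s')) => [|s']; last by rewrite eq_sym.
apply: ler_sum => s' _.
rewrite [X in `|X|](_ : _ =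
  (f s' - f s) * (ip_trans X h s s' / h - jump_rate R G s s') * h * law X t s); last first.
  by field; rewrite gt_eqF.
rewrite 3!normrM (gtr0_norm h0) (ger0_norm (law_ge0 _ _ _)).
by rewrite ler_piMr ?law_le1 // mulr_ge0 ?(ltW h0) // mulr_ge0.
Qed.

End Process.

(** * Weighted means *)

Section Means.
Local Open Scope classical_set_scope.
Local Open Scope ring_scope.

Lemma meanD (R : realType) n (G : sgraph n) (X : interchange_process R G) f g t :
  mean X (fun s => f s + g s) t = mean X f t + mean X g t.
Proof. by rewrite -big_split; apply: eq_bigr => s _; rewrite mulrDl. Qed.

Lemma meanZ (R : realType) n (G : sgraph n) (X : interchange_process R G) c f t :
  mean X (fun s => c * f s) t = c * mean X f t.
Proof. by rewrite /mean mulr_sumr; apply: eq_bigr => s _; rewrite mulrA. Qed.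

Lemma mean_le (R : realType) n (G : sgraph n) (X : interchange_process R G) f g t :
  (forall s, f s <= g s) -> mean X f t <= mean X g t.
Proof. by move=> fg; apply: ler_sum => s _; rewrite ler_wpM2r ?law_ge0. Qed.

Lemma mean_ge_cst (R : realType) n (G : sgraph n) (X : interchange_process R G)
  f c t : 0 <= t -> (forall s, c <= f s) -> c <= mean X f t.
Proof. by move=> t0 cf; rewrite -(mean_cst X c t0); exact: mean_le. Qed.

Lemma mean_le_cst (R : realType) n (G : sgraph n) (X : interchange_process R G)
  f c t : 0 <= t -> (forall s, f s <= c) -> mean X f t <= c.
Proof. by move=> t0 cf; rewrite -(mean_cst X c t0); exact: mean_le. Qed.

Lemma mean_continuous (R : realType) n (G : sgraph n)
  (X : interchange_process R G) (f : 'S_n -> R) : continuous (clip (mean X f)).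
Proof.
apply: (@clip_continuous _ _ (mean X (generator G f)) (\sum_s `|generator G f s|)).
  exact: mean_right_derivative.
move=> t t0; apply: le_trans (ler_norm_sum _ _ _) _; apply: ler_sum => s _.
by rewrite normrM (ger0_norm (law_ge0 _ _ _)) ler_piMr ?law_le1.
Qed.

Lemma mean_is_derive (R : realType) n (G : sgraph n)
    (X : interchange_process R G) (f : 'S_n -> R) (t : R) : 0 < t ->
  is_derive t 1 (clip (mean X f)) (mean X (generator G f) t).
Proof.
move=> t0; apply: clip_is_derive => //; last exact: mean_continuous.
exact: mean_right_derivative.
Qed.

Definition weight (R : realType) n (theta : R) (s : 'S_n) : R :=
  theta ^+ cycle_number s.

Definition weighted_mean (R : realType) n (G : sgraph n)
    (X : interchange_process R G) (theta : R) (f : 'S_n -> R) (t : R) : R :=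
  mean X (fun s => weight theta s * f s) t / mean X (weight theta) t.

Lemma partition_gt0 (R : realType) n (G : sgraph n) (X : interchange_process R G)
  (theta t : R) : 0 < theta -> 0 <= t -> 0 < mean X (weight theta) t.
Proof.
move=> th0 t0; pose c := \prod_(s : 'S_n) Num.min 1 (weight theta s).
have w0 (s : 'S_n) : 0 < weight theta s by rewrite exprn_gt0.
have m0 (s : 'S_n) : 0 < Num.min 1 (weight theta s) by rewrite lt_min ltr01 w0.
apply: (@lt_le_trans _ _ c); first exact: prodr_gt0.
apply: mean_ge_cst => // s; rewrite /c (bigD1 s) //=.
apply: le_trans (_ : Num.min 1 (weight theta s) * 1 <= _).
  rewrite ler_wpM2l ?(ltW (m0 s)) //; apply: prodr_ile1 => s' _.
  by rewrite (ltW (m0 s')) ge_min lexx.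
by rewrite mulr1 ge_min lexx orbT.
Qed.

Lemma weighted_mean_le (R : realType) n (G : sgraph n)
    (X : interchange_process R G) (theta t : R) f g : 0 < theta -> 0 <= t ->
  (forall s, f s <= g s) -> weighted_mean X theta f t <= weighted_mean X theta g t.
Proof.
move=> th0 t0 fg; rewrite ler_wpM2r ?invr_ge0 ?(ltW (partition_gt0 _ _ _)) //.
by apply: mean_le => s; rewrite ler_wpM2l // exprn_ge0 // ltW.
Qed.

Lemma weighted_mean_affine (R : realType) n (G : sgraph n)
    (X : interchange_process R G) (theta t c k : R) f : 0 < theta -> 0 <= t ->
  weighted_mean X theta (fun s => c + k * f s) t = c + k * weighted_mean X theta f t.
Proof.
move=> th0 t0; rewrite /weighted_mean.
have -> : mean X (fun s => weight theta s * (c + k * f s)) t =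
    c * mean X (weight theta) t + k * mean X (fun s => weight theta s * f s) t.
  by rewrite -!meanZ -meanD; apply: eq_bigr => s _; congr (_ * _); ring.
by field; rewrite gt_eqF ?partition_gt0.
Qed.

Lemma weighted_mean_continuous (R : realType) n (G : sgraph n)
    (X : interchange_process R G) (theta : R) f : 0 < theta ->
  continuous (clip (weighted_mean X theta f)).
Proof.
move=> th0 t; apply: cvgM; first exact: mean_continuous.
apply: cvgV; last exact: mean_continuous.
by rewrite gt_eqF // partition_gt0 // le_max lexx orbT.
Qed.

Definition has_large_cycle (R : realType) n (eta : R) (s : 'S_n) : bool :=
  [exists C in porbits s, eta * n%:R < #|C|%:R].

Lemma weighted_large_cycleE (R : realType) n (G : sgraph n)
    (X : interchange_process R G) (theta eta t : R) : 0 <= t ->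
  weighted_large_cycle X theta eta t =
  weighted_mean X theta (fun s => (has_large_cycle eta s)%:R) t.
Proof.
move=> t0; rewrite /weighted_large_cycle /weighted_prob /partition_function.
rewrite (expectation_path X (weight theta)) // /weighted_mean; congr (_ / _).
rewrite -[RHS]/(fine (EFin _)) -expectation_path //; congr (fine 'E__ [_]).
apply/funext => w; congr (_ * _); rewrite indicE; congr (nat_of_bool _)%:R.
apply/idP/exists_inP => [|[C Cp lt]].
  by rewrite inE => -[C Cp lt]; exists C.
by rewrite inE; exists C.
Qed.

End Means.

(** * The evolution of the partition function *)

Section Integral.
Local Open Scope classical_set_scope.
Local Open Scope ring_scope.

Lemma continuous_integrable (R : realType) (u : R -> R) (a b : R) :
  continuous u -> lebesgue_measure.-integrable `[a, b] (EFin \o u).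
Proof.
move=> cu; apply: continuous_compact_integrable; first exact: segment_compact.
exact: continuous_subspaceT.
Qed.

(** The fundamental theorem of calculus for [g], followed by monotonicity. *)
Lemma increment_le_Rintegral (R : realType) (F g u : R -> R) (a b : R) :
  0 <= a -> a <= b -> continuous F -> continuous g -> continuous u ->
  (forall x : R, 0 < x -> is_derive x 1 F (g x)) ->
  (forall x : R, a <= x <= b -> g x <= u x) ->
  F b - F a <= \int[lebesgue_measure]_(t in `[a, b]) u t.
Proof.
move=> a0 ab cF cg cu dF gu.
apply: (@le_trans _ _ (\int[lebesgue_measure]_(t in `[a, b]) g t)); last first.
  apply: le_Rintegral => //; try exact: continuous_integrable.
move: ab; rewrite le_eqVlt => /predU1P[<-|ab].
  by rewrite subrr set_itv1 Rintegral_set1.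
have ftc : (\int[lebesgue_measure]_(x in `[a, b]) (g x)%:E = (F b)%:E - (F a)%:E)%E.
  apply: continuous_FTC2 => //; first exact: continuous_subspaceT.
    split; last 2 first.
    - by apply: cvg_at_right_filter; exact: cF.
    - by apply: cvg_at_left_filter; exact: cF.
    move=> x; rewrite in_itv /= => /andP[ax _].
    by have := dF x (le_lt_trans a0 ax) => dFx; exact: ex_derive.
  move=> x; rewrite in_itv /= => /andP[ax _].
  by rewrite derive1E; have := dF x (le_lt_trans a0 ax) => dFx; exact: derive_val.
by rewrite /Rintegral ftc.
Qed.

End Integral.

Section Potential.
Local Open Scope classical_set_scope.
Local Open Scope ring_scope.

Definition internal_count (R : realType) n (G : sgraph n) (s : 'S_n) : R :=
  #|internal_pairs G s|%:R.

Lemma sum_internal (R : realType) n (G : sgraph n) (s : 'S_n) (x y : R) :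
  \sum_(p in edge_pairs G) (if p.2 \in porbit s p.1 then x else y) =
  x * internal_count R G s + y * (#|edge_pairs G|%:R - internal_count R G s).
Proof.
rewrite (bigID (fun p => p.2 \in porbit s p.1)) /=.
under eq_bigr => p /andP[_ ->] do [].
under [X in _ + X]eq_bigr => p /andP[_ /negbTE ->] do [].
have cI : (\sum_(p in edge_pairs G | p.2 \in porbit s p.1) 1)%N = #|internal_pairs G s|.
  by rewrite -sum1_card; apply: eq_bigl => p; rewrite !inE.
have cE : #|edge_pairs G| = (#|internal_pairs G s| +
    \sum_(p in edge_pairs G | p.2 \notin porbit s p.1) 1)%N.
  by rewrite -sum1_card (bigID (fun p => p.2 \in porbit s p.1)) /= cI.
rewrite cE /internal_count natrD [X in y * X]addrAC subrr add0r.
rewrite -cI !natr_sum !mulr_sumr.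
by congr (_ + _); apply: eq_bigr => p _; rewrite mulr1.
Qed.

Lemma edge_pairs_neq n (G : sgraph n) p : p \in edge_pairs G -> p.1 != p.2.
Proof. by rewrite inE => /andP[_ /edge_neq]. Qed.

(** A jump along an internal edge multiplies the weight by [theta], and any other
    jump divides it by [theta]. *)
Lemma generator_weight (R : realType) n (G : sgraph n) (theta : R) (s : 'S_n) :
  0 < theta ->
  generator G (weight theta) s = (theta - 1) / theta * (weight theta s *
    ((1 + theta) * internal_count R G s - #|edge_pairs G|%:R)).
Proof.
move=> th0; have thN0 : theta != 0 by rewrite gt_eqF.
rewrite /generator.
under eq_bigr => p pE.
  rewrite (_ : _ - _ = weight theta s *
    (if p.2 \in porbit s p.1 then theta - 1 else theta^-1 - 1)); last first.
    rewrite /weight; have := cycle_number_mul_tperm s (edge_pairs_neq pE).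
    move: (cycle_number s) (cycle_number _) => N N'.
    case: (p.2 \in _) => /=; first by rewrite addn0 => ->; rewrite exprS; ring.
    by rewrite addn2 => -[<-]; rewrite exprS; field.
  over.
rewrite -mulr_sumr sum_internal; field; exact: thN0.
Qed.

Lemma generator_cycle_number (R : realType) n (G : sgraph n) (s : 'S_n) :
  generator G (fun s => (cycle_number s)%:R) s =
    2 * internal_count R G s - #|edge_pairs G|%:R.
Proof.
rewrite /generator.
under eq_bigr => p pE.
  rewrite (_ : _ - _ = if p.2 \in porbit s p.1 then 1 else - 1); last first.
    have := cycle_number_mul_tperm s (edge_pairs_neq pE).
    move: (cycle_number s) (cycle_number _) => N N'.
    case: (p.2 \in _) => /=; first by rewrite addn0 => ->; rewrite -natr1; ring.
    by rewrite addn2 => -[<-]; rewrite -natr1; ring.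
  over.
by rewrite sum_internal; ring.
Qed.

(** The constant [kappa] of the introduction, extended to [theta = 1] by
    continuity. *)
Definition entropy_cost (R : realType) (theta : R) : R :=
  if theta == 1 then 1 else theta * ln theta / (theta - 1).

(** [F] is [theta / (theta - 1) * ln Z], or the mean number of cycles when
    [theta = 1].  Its increments are bounded below because the number of cycles
    lies between [0] and [n]. *)
Lemma potential_exists (R : realType) n (G : sgraph n)
    (X : interchange_process R G) (theta : R) : 0 < theta ->
  exists F : R -> R, [/\ continuous F,
    forall x : R, 0 < x -> is_derive x 1 F
      ((1 + theta) * weighted_mean X theta (internal_count R G) x
       - #|edge_pairs G|%:R)
  & forall a b : R, 0 <= a -> 0 <= b -> - (entropy_cost theta * n%:R) <= F b - F a].
Proof.
move=> th0; rewrite /entropy_cost; have [->|th1] := eqVneq theta 1.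
  exists (clip (mean X (fun s => (cycle_number s)%:R))).
  split; first exact: mean_continuous.
    move=> x x0; have := mean_is_derive X (fun s => (cycle_number s)%:R) x0.
    congr (is_derive _ _ _ _).
    have -> : mean X (generator G (fun s => (cycle_number s)%:R)) x =
        mean X (fun s => - #|edge_pairs G|%:R + 2 * internal_count R G s) x.
      by apply: eq_bigr => s _; rewrite generator_cycle_number addrC.
    have w1 : weight (1 : R) = (fun=> 1 : R) :> ('S_n -> R).
      by apply/funext => s; rewrite /weight expr1n.
    rewrite meanD meanZ mean_cst ?(ltW x0) // /weighted_mean w1 mean_cst ?(ltW x0) //.
    rewrite divr1 addrC; congr (2 * _ - _).
    by apply: eq_bigr => s _; rewrite mul1r.
  move=> a b a0 b0; rewrite mul1r /clip !max_l //.
  have h1 : 0 <= mean X (fun s => (cycle_number s)%:R) b by apply: mean_ge_cst.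
  have h2 : mean X (fun s => (cycle_number s)%:R) a <= n%:R.
    by apply: mean_le_cst => // s; rewrite ler_nat cycle_number_le.
  by lra.
have thN0 : theta != 0 by rewrite gt_eqF.
have th10 : theta - 1 != 0 by rewrite subr_eq0.
set Z := mean X (weight theta).
have Z0 x : 0 < clip Z x by apply: partition_gt0; rewrite // le_max lexx orbT.
exists (fun x => theta / (theta - 1) * ln (clip Z x)).
split.
- move=> x; apply: cvgMr; apply: (cvg_comp (clip Z) (@ln R)); first exact: mean_continuous.
  by apply: continuous_ln; exact: Z0.
- move=> x x0; have dZ := mean_is_derive X (weight theta) x0.
  have dln := is_derive1_comp (is_derive1_ln (Z0 x)) dZ.
  have := is_deriveZ (theta / (theta - 1)) dln.
  congr (is_derive _ _ _ _).
  have -> : mean X (generator G (weight theta)) x = (theta - 1) / theta *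
      (- #|edge_pairs G|%:R * Z x +
       (1 + theta) * mean X (fun s => weight theta s * internal_count R G s) x).
    rewrite -!meanZ -meanD -meanZ; apply: eq_bigr => s _; rewrite generator_weight //.
    by congr (_ * _); ring.
  rewrite /clip max_l ?(ltW x0) // /weighted_mean /GRing.scale /=.
  have Zx : Z x != 0 by rewrite gt_eqF // partition_gt0 // ltW.
  by rewrite -/Z; field; rewrite Zx thN0 th10.
move=> a b a0 b0; rewrite /clip !max_l // -mulrBr.
have wn x : 0 <= x -> 1 <= theta -> 0 <= ln (Z x) <= ln theta * n%:R.
  move=> x0 th; rewrite ln_ge0 ?mean_ge_cst //=; last by move=> s; exact: exprn_ege1.
  rewrite mulr_natr -lnXn // ler_ln ?posrE ?exprn_gt0 ?partition_gt0 //.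
  by apply: mean_le_cst => // s; rewrite ler_weXn2l // cycle_number_le.
have wn' x : 0 <= x -> theta <= 1 -> ln theta * n%:R <= ln (Z x) <= 0.
  move=> x0 th; rewrite ln_le0 ?andbT; last first.
    by apply: mean_le_cst => // s; apply: exprn_ile1 => //; exact: ltW.
  rewrite mulr_natr -lnXn // ler_ln ?posrE ?exprn_gt0 ?partition_gt0 //.
  by apply: mean_ge_cst => // s; rewrite ler_wiXn2l ?(ltW th0) // cycle_number_le.
have [th|th] := leP theta 1.
  have /andP[h1 h2] := wn' a a0 th; have /andP[h3 h4] := wn' b b0 th.
  have neg : theta / (theta - 1) < 0.
    by rewrite pmulr_rlt0 // invr_lt0 subr_lt0 lt_neqAle th1.
  rewrite (_ : - _ = theta / (theta - 1) * (- (ln theta * n%:R))); last by ring.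
  by rewrite ler_nM2l //; lra.
have /andP[h1 h2] := wn a a0 (ltW th); have /andP[h3 h4] := wn b b0 (ltW th).
have pos : 0 < theta / (theta - 1) by rewrite divr_gt0 // subr_gt0.
rewrite (_ : - _ = theta / (theta - 1) * (- (ln theta * n%:R))); last by ring.
by rewrite ler_pM2l //; lra.
Qed.

End Potential.

(** * Large cycles *)

Section Main.
Local Open Scope classical_set_scope.
Local Open Scope ring_scope.

Lemma entropy_cost_gt0 (R : realType) (theta : R) : 0 < theta -> 0 < entropy_cost theta.
Proof.
move=> th0; rewrite /entropy_cost; have [_|th1] := eqVneq theta 1; first exact: ltr01.
rewrite -mulrA pmulr_rgt0 //; have [th|th] := ltP 1 theta.
  by rewrite divr_gt0 ?ln_gt0 // subr_gt0.
have {}th : theta < 1 by rewrite lt_neqAle th1.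
by rewrite nmulr_rgt0 ?invr_lt0 ?subr_lt0 // ln_lt0 // th0.
Qed.

Lemma critical_time_cost (R : realType) (theta : R) d :
  0 < theta -> 2 * (1 + theta) < d%:R ->
  critical_time theta d * (d%:R / 2 - (1 + theta)) = entropy_cost theta.
Proof.
move=> th0 dth; rewrite /critical_time /entropy_cost.
have [th|th1] := eqVneq theta 1.
  by rewrite th in dth *; field; rewrite gt_eqF //; lra.
have h1 : theta - 1 != 0 by rewrite subr_eq0.
have h2 : d%:R - 2 * (1 + theta) != 0 by rewrite subr_eq0 gt_eqF.
by field; rewrite h1 h2.
Qed.

(** If all cycles have at most [n / M] vertices, sparsity applies to each of them
    and their sizes add up to [n]; otherwise the number [n * d / 2] of all edges
    is used as a bound. *)
Lemma internal_count_le (R : realType) n d q M (G : sgraph n) (eps : R) (s : 'S_n) :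
  regular d G -> sparse q M G -> (0 < q)%N -> (0 < M)%N -> q%:R^-1 <= eps ->
  eps < (d%:R - 2) / 2 ->
  internal_count R G s <=
    (1 + eps) * n%:R + n%:R * (d%:R / 2 - (1 + eps)) * (has_large_cycle (M%:R^-1 : R) s)%:R.
Proof.
move=> rG sG q0 M0 qe ed; rewrite /internal_count.
have n0 : 0 <= n%:R :> R by [].
have E2 : #|edge_pairs G|%:R = n%:R * d%:R / 2 :> R.
  have := card_edge_pairs rG; rewrite -muln2 => /(congr1 (fun k => k%:R : R)).
  by rewrite !natrM => <-; field.
have [_|/exists_inPn small] := boolP (has_large_cycle _ s).
  rewrite mulr1; apply: le_trans (_ : #|edge_pairs G|%:R <= _).
    by rewrite ler_nat card_internal_pairs_le.
  by rewrite E2; lra.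
rewrite mulr0 addr0.
have := @sparse_internal_pairs n q M G s sG.
have hsmall C : C \in porbits s -> (#|C| * M <= n)%N.
  move=> /small; rewrite -leNgt -(ler_nat R) natrM.
  by rewrite -ler_pdivlMr ?ltr0n // mulrC.
move=> /(_ hsmall); rewrite -(ler_nat R) !natrM -ler_pdivlMr ?ltr0n // => h.
apply: le_trans h _; rewrite mulrAC ler_wpM2r // -natr1 mulrDl divff ?pnatr_eq0 -?lt0n //.
by rewrite mul1r; lra.
Qed.

(** [internal_count_le] turns the potential of [potential_exists], corrected by a
    linear term and rescaled, into a function [H] whose derivative is at most the
    weighted probability of a large cycle. *)
Lemma integral_large_cycle (R : realType) n d q M (G : sgraph n)
    (X : interchange_process R G) (theta eps a b : R) :
  0 < theta -> 2 * (1 + theta) < d%:R -> (0 < n)%N ->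
  regular d G -> sparse q M G -> (0 < q)%N -> (0 < M)%N -> q%:R^-1 <= eps ->
  eps < (d%:R - 2) / 2 -> 0 <= a <= b ->
  ((b - a) * (d%:R / 2 - (theta + 1) * (1 + eps))
     - critical_time theta d * (d%:R / 2 - (1 + theta)))
    / ((1 + theta) * (d%:R / 2 - (1 + eps)))
  <= \int[lebesgue_measure]_(t in `[a, b])
       clip (weighted_mean X theta (fun s => (has_large_cycle (M%:R^-1 : R) s)%:R)) t.
Proof.
move=> th0 dth n0 rG sG q0 M0 qe ed /andP[a0 ab]; rewrite critical_time_cost //.
have [F [cF dF incF]] := potential_exists X th0.
pose k : R := d%:R / 2 - (1 + eps); have k0 : 0 < k by rewrite /k; lra.
have nR : 0 < n%:R :> R by rewrite ltr0n.
pose K := (1 + theta) * n%:R * k; have K0 : 0 < K by rewrite !mulr_gt0 //; lra.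
pose I := weighted_mean X theta (internal_count R G).
pose E : R := #|edge_pairs G|%:R; pose l := E - (1 + theta) * (1 + eps) * n%:R.
have EE : E = n%:R * d%:R / 2.
  have := card_edge_pairs rG; rewrite -muln2 => /(congr1 (fun k => k%:R : R)).
  by rewrite !natrM -/E => <-; field.
pose H t := K^-1 * (F t + l * t).
pose h t := K^-1 * ((1 + theta) * clip I t - E + l).
apply: (@le_trans _ _ (H b - H a)).
  have := incF a b a0 (le_trans a0 ab).
  move=> incr; set cost := entropy_cost theta in incr *.
  set num := _ - cost; rewrite (_ : num / _ = K^-1 * (n%:R * num)); last first.
    by rewrite /K -/k; field; rewrite !gt_eqF //; lra.
  rewrite /H -mulrBr ler_wpM2l ?invr_ge0 ?(ltW K0) // /num /l EE.
  rewrite -subr_ge0 in incr; rewrite -subr_ge0; apply: le_trans incr _.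
  by rewrite le_eqVlt; apply/orP; left; apply/eqP; field.
apply: (@increment_le_Rintegral _ H h) => //.
- move=> x; apply: cvgMr; apply: cvgD; first exact: cF.
  by apply: cvgMr; exact: cvg_id.
- move=> x; apply: cvgMr; apply: cvgD; last exact: cvg_cst.
  apply: cvgB; last exact: cvg_cst.
  by apply: cvgMr; exact: weighted_mean_continuous.
- exact: weighted_mean_continuous.
- move=> x x0.
  have := is_deriveZ K^-1 (is_deriveD (dF x x0) (is_deriveZ l (is_derive_id x 1))).
  congr (is_derive _ _ _ _).
  by rewrite /h /clip max_l ?(ltW x0) // /GRing.scale /= mulr1.
move=> x /andP[ax _]; have x0 := le_trans a0 ax; rewrite /h /clip max_l //.
set u := weighted_mean _ _ _ _.
have : I x <= (1 + eps) * n%:R + n%:R * k * u.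
  rewrite -weighted_mean_affine //; apply: weighted_mean_le => // s.
  exact: internal_count_le qe ed.
rewrite ler_pdivrMl // /l /K => hI.
have : (1 + theta) * I x <= (1 + theta) * ((1 + eps) * n%:R + n%:R * k * u).
  by rewrite ler_pM2l //; lra.
lra.
Qed.

(** The complementary probability is at most the scale divided by [n]. *)
Lemma regular_prob_cvg1 (R : realType) d q 
    (A : forall n, sgraph n -> Prop) : (2 < d)%N -> (0 < q)%N ->
  (forall n (G : sgraph n), (0 < n)%N -> regular d G ->
    sparse q (sparsity_scale d q) G -> A n G) ->
  regular_prob R d (@A n) @[n --> even_infty d] --> (1 : R).
Proof.
set M := sparsity_scale d q.
move=> d2 q0 hA; apply/cvgrPdist_le => e e0.
rewrite near_withinE; exists (maxn (8 * d.+1) (Num.truncn (M%:R / e)).+1) => //.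
move=> n /=; rewrite geq_max => /andP[nd nM] ev; rewrite /regular_prob.
set p := #|_|; set r := #|_|.
have r0 : (0 < r)%N by apply: regular_exists => //; lia.
have pr : (p <= r)%N.
  by apply: subset_leq_card; apply/fintype.subsetP => G; rewrite !inE => /andP[].
have n0 : (0 < n)%N by lia.
have bad : (n * (r - p) <= M * r)%N.
  apply: leq_trans (card_not_sparse d2 q0 nd); rewrite leq_mul2l; apply/orP; right.
  rewrite leq_subLR /r /p -cardsUI; apply: leq_trans (leq_addr _ _).
  apply: subset_leq_card; apply/fintype.subsetP => G; rewrite !inE => rG.
  rewrite rG /=; have [sG|] := boolP (sparse q M G); last by rewrite orbT.
  by rewrite orbF; apply/asboolP; exact: hA.
rewrite ger0_norm; last by rewrite subr_ge0 ler_pdivrMr ?ltr0n // mul1r ler_nat.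
rewrite -[X in X - _](@divff _ r%:R) ?pnatr_eq0 -?lt0n // -mulrBl -natrB //.
rewrite ler_pdivrMr ?ltr0n //.
have nMe : M%:R <= e * n%:R.
  rewrite mulrC -ler_pdivrMr //; apply/ltW/(lt_le_trans (truncnS_gt _)).
  by rewrite ler_nat.
rewrite -(@ler_pM2l _ n%:R) ?ltr0n // -natrM.
apply: le_trans (_ : (M * r)%:R <= _); first by rewrite ler_nat.
by rewrite natrM mulrA ler_wpM2r // mulrC.
Qed.

Lemma exists_ge_of_integral (R : realType) (u : R -> R) (a b c : R) :
  continuous u -> a <= b -> c * (b - a) < \int[lebesgue_measure]_(t in `[a, b]) u t ->
  exists2 t, a <= t <= b & c <= u t.
Proof.
move=> cu ab; apply: contraPP => no; apply/negP; rewrite -leNgt.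
have cst : \int[lebesgue_measure]_(t in `[a, b]) c = c * (b - a).
  rewrite Rintegral_cst //; congr (_ * _).
  rewrite /= lebesgue_measure_itv /= lte_fin; move: ab.
  by rewrite le_eqVlt => /predU1P[->|->]; rewrite ?ltxx ?subrr.
rewrite -cst; apply: le_Rintegral => //; try exact: continuous_integrable.
  by apply: continuous_integrable; exact: cst_continuous.
move=> t /=; rewrite in_itv /= => tab; apply: contra_notT no; rewrite -ltNge => /ltW.
by exists t.
Qed.

End Main.

Local Open Scope classical_set_scope.
Local Open Scope ring_scope.

Theorem theorem2 (R : realType) (theta : R) (d : nat)
    (X : forall (n : nat) (G : sgraph n), interchange_process R G)
    (theta_gt0 : 0 < theta) (d_gt : 2 * (1 + theta) < d%:R) :
  (forall eps : R, 0 < eps < (d%:R - 2) / 2 ->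
    exists2 eta : R, 0 < eta &
      forall a b : R, 0 <= a <= b ->
        regular_prob R d (fun G : sgraph n =>
          \int[lebesgue_measure]_(t in `[a, b])
             weighted_large_cycle (X n G) theta eta t >=
          ((b - a) * (d%:R / 2 - (theta + 1) * (1 + eps))
             - critical_time theta d * (d%:R / 2 - (1 + theta)))
          / ((1 + theta) * (d%:R / 2 - (1 + eps))))
        @[n --> even_infty d] --> (1 : R))
  /\
  (forall delta : R, 0 < delta ->
    exists eta c : R, [/\ 0 < eta, 0 < c &
      forall a : R, 0 <= a ->
        regular_prob R d (fun G : sgraph n =>
          exists2 t : R, a <= t <= a + critical_time theta d + delta &
            weighted_large_cycle (X n G) theta eta t >= c)
        @[n --> even_infty d] --> (1 : R)]).
Proof.
have d3 : (2 < d)%N.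
  by rewrite -(ltr_nat R); apply: lt_trans d_gt; lra.
have itvE n (G : sgraph n) (eta a b : R) : 0 <= a ->
    \int[lebesgue_measure]_(t in `[a, b]) weighted_large_cycle (X n G) theta eta t =
    \int[lebesgue_measure]_(t in `[a, b])
      clip (weighted_mean (X n G) theta (fun s => (has_large_cycle eta s)%:R)) t.
  move=> a0; apply: eq_Rintegral => t; rewrite inE /= in_itv /= => /andP[at' _].
  have t0 := le_trans a0 at'; by rewrite weighted_large_cycleE // /clip max_l.
have natE (eps : R) : 0 < eps -> exists2 q, (0 < q)%N & q%:R^-1 <= eps.
  move=> e0; exists (Num.truncn eps^-1).+1 => //.
  by rewrite invf_ple ?posrE ?ltr0n // ltW // truncnS_gt.
pose M := sparsity_scale d.
have M0 q : (0 < M q)%N by rewrite muln_gt0 expn_gt0; lia.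
split=> [eps /andP[e0 ed]|delta delta0].
  have [q q0 qe] := natE eps e0; exists (M q)%:R^-1; first by rewrite invr_gt0 ltr0n.
  move=> a b /andP[a0 ab]; apply: (@regular_prob_cvg1 _ d q) => // n G n0 rG sG.
  rewrite itvE //.
  apply: (integral_large_cycle (X n G) theta_gt0 d_gt n0 rG sG q0 (M0 q) qe ed).
  by rewrite a0.
set T := critical_time theta d.
pose A : R := d%:R / 2 - (1 + theta); have A0 : 0 < A by rewrite /A; lra.
have TA : T * A = entropy_cost theta by apply: critical_time_cost.
have T0 : 0 < T by rewrite -(pmulr_lgt0 _ A0) TA entropy_cost_gt0.
have Td0 : 0 < T + delta by lra.
have th1 : 0 < 1 + theta by lra.
(* The numerator of (i) on an interval of length T + delta is
   delta * A - (T + delta) * (1 + theta) * eps; this choice of eps keeps it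
   at least delta * A / 2. *)
pose eps := Num.min (delta * A / (2 * ((T + delta) * (1 + theta)))) ((d%:R - 2) / 4).
have e0 : 0 < eps.
  by rewrite lt_min !divr_gt0 ?mulr_gt0 //; lra.
have ed : eps < (d%:R - 2) / 2.
  by rewrite gt_min; apply/orP; right; lra.
have eA : eps * (2 * ((T + delta) * (1 + theta))) <= delta * A.
  by rewrite -ler_pdivlMr ?mulr_gt0 // ge_min lexx.
have [q q0 qe] := natE eps e0.
pose k : R := (1 + theta) * (d%:R / 2 - (1 + eps)).
have k0 : 0 < k by rewrite mulr_gt0 //; lra.
(* A lower bound on the integral, hence v / (T + delta) on the average. *)
pose v : R := delta * A / 2 / k; have v0 : 0 < v by rewrite divr_gt0 // divr_gt0 // mulr_gt0.
exists (M q)%:R^-1, (v / 2 / (T + delta)); split.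
- by rewrite invr_gt0 ltr0n.
- by rewrite divr_gt0 // divr_gt0.
move=> a a0; apply: (@regular_prob_cvg1 _ d q) => // n G n0 rG sG.
have ab : a <= a + T + delta by lra.
pose u := weighted_mean (X n G) theta (fun s => (has_large_cycle ((M q)%:R^-1 : R) s)%:R).
have cu : continuous (clip u) by exact: weighted_mean_continuous.
have big : v / 2 / (T + delta) * (a + T + delta - a) <
    \int[lebesgue_measure]_(t in `[a, a + T + delta]) clip u t.
  have length : a + T + delta - a = T + delta by ring.
  rewrite length divfK ?gt_eqF //.
  have := integral_large_cycle (X n G) theta_gt0 d_gt n0 rG sG q0 (M0 q) qe ed
    (a := a) (b := a + T + delta).
  rewrite a0 ab => /(_ isT); apply: lt_le_trans.
  apply: (@lt_le_trans _ _ v); first by lra.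
  rewrite /v ler_pM2r ?invr_gt0 // -/T -/A length.
  have -> : d%:R / 2 - (theta + 1) * (1 + eps) = A - (1 + theta) * eps.
    by rewrite /A; ring.
  lra.
have [t /andP[at' tb] ct] := exists_ge_of_integral cu ab big.
exists t; first by rewrite at' tb.
have t0 := le_trans a0 at'.
by rewrite weighted_large_cycleE // -/u; rewrite /clip max_l // in ct.
Qed.
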